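(* Let $H$ be a finite-dimensional Hopf algebra over a field $k$. Then $\mathcal{B}_H$ is Noetherian and $S(t_H)_{\Theta}$ is a finitely generated projective $\mathcal{B}_H$-module. Moreover, $S(t_H)_{\Theta}$ is a generator as a $\mathcal{B}_H$-module.
   Context: $k$ is a field; algebras are associative unital $k$-algebras, coalgebras are coassociative counital $k$-coalgebras, and $\otimes=\otimes_k$. Sweedler notation without summation sign: $\Delta(x)=x_1\otimes x_2$, $\Delta^{(2)}(x)=x_1\otimes x_2\otimes x_3$, etc.; $\varepsilon$ is the counit. Let $H$ be a Hopf algebra over $k$. Let $t_H$ be a copy of the underlying vector space of $H$, with identity map $H\to t_H$ written $x\mapsto t_x$, and let $S(t_H)$ be the symmetric algebra of $t_H$. There is a unique linear map $x\mapsto t^{-1}_x$ from $H$ to the field of fractions $\mathrm{Frac}\,S(t_H)$ such that $t_{x_1}t^{-1}_{x_2}=t^{-1}_{x_1}t_{x_2}=\varepsilon(x)1$ for all $x\in H$. $S(t_H)_\Theta$ denotes the subalgebra of $\mathrm{Frac}\,S(t_H)$ generated by all $t_x$ and $t_x^{-1}$ ($x\in H$). For $x,y\in H$ put $\sigma(x,y)=t_{x_1}t_{y_1}t^{-1}_{x_2y_2}$ and $\sigma^{-1}(x,y)=t_{x_1y_1}t^{-1}_{x_2}t^{-1}_{y_2}$ in $S(t_H)_\Theta$. $\mathcal{B}_H$ denotes the subalgebra of $S(t_H)_\Theta$ generated by all $\sigma(x,y)$ and $\sigma^{-1}(x,y)$, $x,y\in H$; $S(t_H)_\Theta$ is regarded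 as a $\mathcal{B}_H$-module by multiplication. *)

(* Defs.v *)
From HB Require Import structures.
From mathcomp Require Import all_boot all_order all_algebra all_field.
From mathcomp Require Import fraction mpoly.
From mathcomp Require Import boolp.

Set Implicit Arguments.
Unset Strict Implicit.
Unset Printing Implicit Defensive.

Import GRing.Theory.
Local Open Scope ring_scope.

(* Finite-dimensional tensor products: V (x) W is the space of coordinate
   matrices in the bases (e_i (x) e_j), where (e_i) and (e_j) are the canonical
   bases of V and W; [tens_sum] and [sweedlerE] give the universal property. *)
Section Tensor.
Context {k : fieldType}.

Definition ebas (V : vectType k) (i : 'I_(\dim {:V})) : V := (vbasis {:V})`_i.
Definition ecrd (V : vectType k) (i : 'I_(\dim {:V})) : V -> k :=
  coord (vbasis {:V}) i.

Definition tens (V W : vectType k) := 'M[k]_(\dim {:V}, \dim {:W}).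

Definition tensor (V W : vectType k) (v : V) (w : W) : tens V W :=
  \matrix_(i, j) (ecrd i v * ecrd j w).

(* Sweedler notation: every z decomposes as
   z = \sum_j (\sum_i z i j *: e_i) (x) e_j, and [sweedler z f] is the sum of
   f z_1 z_2 along this decomposition. By [sweedlerE], when f is bilinear any
   other decomposition gives the same value. *)
Definition sweedler (V W : vectType k) (U : nmodType) (z : tens V W)
    (f : V -> W -> U) : U :=
  \sum_j f (\sum_i z i j *: ebas i) (ebas j).

Lemma ecrdK (V : vectType k) (v : V) : v = \sum_i ecrd i v *: ebas i.
Proof. exact/coord_vbasis/memvf. Qed.

Lemma ecrd_ebas (V : vectType k) i j :
  ecrd i (ebas j : V) = (i == j)%:R.
Proof. by rewrite /ecrd /ebas coord_free ?(basis_free (vbasisP _)) // eq_sym. Qed.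

Lemma ecrd_sum (V : vectType k) (c : 'I_(\dim {:V}) -> k) i :
  ecrd i (\sum_l c l *: ebas l : V) = c i.
Proof.
rewrite /ecrd linear_sum (bigD1 i) //= linearZ /= -/(ecrd _ _) ecrd_ebas.
rewrite eqxx mulr1 big1 ?addr0 // => m nmi.
by rewrite linearZ /= -/(ecrd _ _) ecrd_ebas eq_sym (negPf nmi) mulr0.
Qed.

Lemma tensorDl (V W : vectType k) (v v' : V) (w : W) :
  tensor (v + v') w = tensor v w + tensor v' w.
Proof. by apply/matrixP=> i j; rewrite !mxE /ecrd linearD mulrDl. Qed.

Lemma tensorDr (V W : vectType k) (v : V) (w w' : W) :
  tensor v (w + w') = tensor v w + tensor v w'.
Proof. by apply/matrixP=> i j; rewrite !mxE /ecrd linearD mulrDr. Qed.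

Lemma tensorZl (V W : vectType k) c (v : V) (w : W) :
  tensor (c *: v) w = c *: tensor v w.
Proof. by apply/matrixP=> i j; rewrite !mxE /ecrd linearZ -mulrA. Qed.

Lemma tensorZr (V W : vectType k) c (v : V) (w : W) :
  tensor v (c *: w) = c *: tensor v w.
Proof. by apply/matrixP=> i j; rewrite !mxE /ecrd linearZ /= mulrCA. Qed.

Lemma tens_sum (V W : vectType k) (z : tens V W) :
  z = sweedler z (@tensor V W).
Proof.
apply/matrixP=> i j.
rewrite /sweedler summxE (bigD1 j) //= mxE ecrd_sum ecrd_ebas eqxx mulr1.
rewrite big1 ?addr0 // => l nlj.
by rewrite mxE ecrd_ebas eq_sym (negPf nlj) mulr0.
Qed.

Section Balanced.
Variables (V W : vectType k) (U : zmodType) (f : V -> W -> U).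
Hypothesis fDl : forall v v' w, f (v + v') w = f v w + f v' w.
Hypothesis fDr : forall v w w', f v (w + w') = f v w + f v w'.
Hypothesis fZ : forall c v w, f (c *: v) w = f v (c *: w).

Let f0l w : f 0 w = 0.
Proof. by apply: (addrI (f 0 w)); rewrite -fDl !addr0. Qed.
Let f0r v : f v 0 = 0.
Proof. by apply: (addrI (f v 0)); rewrite -fDr !addr0. Qed.
Let f_suml I r (P : pred I) F w :
  f (\sum_(i <- r | P i) F i) w = \sum_(i <- r | P i) f (F i) w.
Proof. by apply: (big_morph (f^~ w)) => // v v'; apply: fDl. Qed.
Let f_sumr I r (P : pred I) F v :
  f v (\sum_(i <- r | P i) F i) = \sum_(i <- r | P i) f v (F i).
Proof. by apply: (big_morph (f v)) => // w w'; apply: fDr. Qed.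

Lemma sweedlerD (z z' : tens V W) :
  sweedler (z + z') f = sweedler z f + sweedler z' f.
Proof.
rewrite /sweedler -big_split /=; apply: eq_bigr => j _; rewrite -fDl.
by congr (f _ _); rewrite -big_split; apply: eq_bigr => i _; rewrite mxE scalerDl.
Qed.

Lemma sweedler0 : sweedler (0 : tens V W) f = 0.
Proof. by apply: (addrI (sweedler 0 f)); rewrite -sweedlerD !addr0. Qed.

Lemma sweedler_sum I r (P : pred I) (F : I -> tens V W) :
  sweedler (\sum_(i <- r | P i) F i) f = \sum_(i <- r | P i) sweedler (F i) f.
Proof.
by apply: (big_morph (fun z => sweedler z f)) => [z z'|];
  [exact: sweedlerD | exact: sweedler0].
Qed.

Lemma sweedler_tensor v w : sweedler (tensor v w) f = f v w.
Proof.
rewrite [in RHS](ecrdK w) f_sumr; apply: eq_bigr => j _.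
rewrite -fZ; congr (f _ _); rewrite [in RHS](ecrdK v) scaler_sumr.
by apply: eq_bigr => i _; rewrite mxE scalerA mulrC.
Qed.

Lemma sweedlerE (s : seq (V * W)) (z : tens V W) :
  z = \sum_(p <- s) tensor p.1 p.2 ->
  sweedler z f = \sum_(p <- s) f p.1 p.2.
Proof.
move=> ->; rewrite sweedler_sum.
by apply: eq_bigr => p _; rewrite sweedler_tensor.
Qed.
End Balanced.
End Tensor.

(* The compatibility axioms are written in Sweedler notation; [comul_coassoc]
   is an identity in H (x) (H (x) H). The type falgType carries no data beyond
   a finite-dimensional nonzero unital associative algebra. *)
HB.mixin Record isHopf (k : fieldType) H of Falgebra k H := {
  comul : {linear H -> tens H H};
  counit : {linear H -> k^o};
  antipode : {linear H -> H};
  comul_coassoc : forall x : H,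
    sweedler (comul x) (fun x1 x2 => tensor x1 (comul x2)) =
    sweedler (comul x) (fun x1 x2 =>
      sweedler (comul x1) (fun y1 y2 => tensor y1 (tensor y2 x2)));
  counit_comul : forall x : H,
    sweedler (comul x) (fun x1 x2 => (counit x1 : k) *: x2) = x;
  comul_counit : forall x : H,
    sweedler (comul x) (fun x1 x2 => (counit x2 : k) *: x1) = x;
  comul1 : comul 1 = tensor 1 1;
  comulM : forall x y : H,
    comul (x * y) =
    sweedler (comul x) (fun x1 x2 =>
      sweedler (comul y) (fun y1 y2 => tensor (x1 * y1) (x2 * y2)));
  counit1 : counit 1 = 1;
  counitM : forall x y : H, counit (x * y) = counit x * counit y;
  antipode_l : forall x : H,
    sweedler (comul x) (fun x1 x2 => antipode x1 * x2) = (counit x : k)%:A;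
  antipode_r : forall x : H,
    sweedler (comul x) (fun x1 x2 => x1 * antipode x2) = (counit x : k)%:A
}.

#[short(type="fdHopfType")]
HB.structure Definition Hopf (k : fieldType) :=
  {H of isHopf k H & Falgebra k H}.

(* The symmetric algebra of V, in the coordinates of the canonical basis; its
   universal property is [symalg_lift] and [symalg_lift_uniq]. *)
Section SymmetricAlgebra.
Variables (k : fieldType) (V : vectType k).

Definition symalg := {mpoly k[\dim {:V}]}.
HB.instance Definition _ := GRing.IntegralDomain.on symalg.
HB.instance Definition _ := GRing.ComAlgebra.on symalg.

Definition symvar (x : V) : symalg := \sum_i ecrd i x *: 'X_i.

Lemma symvar_is_linear : linear symvar.
Proof.
move=> c x y; rewrite /symvar scaler_sumr -big_split /=.
by apply: eq_bigr => i _; rewrite /ecrd linearP scalerDl scalerA.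
Qed.
HB.instance Definition _ := GRing.isLinear.Build k V symalg _ symvar
  symvar_is_linear.

Lemma symvar_ebas i : symvar (ebas i) = 'X_i.
Proof.
rewrite /symvar (bigD1 i) //= big1 => [|j nji].
  by rewrite ecrd_ebas eqxx scale1r addr0.
by rewrite ecrd_ebas (negPf nji) scale0r.
Qed.

Lemma symalg_lift (A : comAlgType k) (f : {linear V -> A}) :
  {g : {lrmorphism symalg -> A} | forall x, g (symvar x) = f x}.
Proof.
pose g : {rmorphism symalg -> A} := mmap (in_alg A) (fun i => f (ebas i)).
have g_is_scalable : scalable g.
  by move=> c p; rewrite -[RHS]mulr_algl; apply: mmapZ.
pose gL := GRing.isScalable.Build k symalg A _ g g_is_scalable.
pose gM : {lrmorphism symalg -> A} := HB.pack (GRing.RMorphism.sort g) gL.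
exists gM => x; rewrite /symvar linear_sum [in RHS](ecrdK x) linear_sum.
apply: eq_bigr => i _; rewrite !linearZ /=; congr (_ *: _).
by rewrite /g mmapX mmap1U.
Qed.

Lemma symalg_lift_uniq (A : comAlgType k) (g h : {lrmorphism symalg -> A}) :
  (forall x, g (symvar x) = h (symvar x)) -> g =1 h.
Proof.
move=> gh p; rewrite (mpolyE p) !linear_sum; apply: eq_bigr => m _.
rewrite !linearZ /= mpolyXE_id !rmorph_prod; congr (_ *: _).
by apply: eq_bigr => i _; rewrite !rmorphXn /= -symvar_ebas gh.
Qed.

Definition symfrac := {fraction symalg}.
HB.instance Definition _ := GRing.Field.on symfrac.

Definition symfrac_scalar (c : k) : symfrac := tofrac (c%:A : symalg).
Definition symfrac_scale (c : k) (x : symfrac) : symfrac :=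
  symfrac_scalar c * x.

Fact symfrac_scaleA a b v :
  symfrac_scale a (symfrac_scale b v) = symfrac_scale (a * b) v.
Proof.
by rewrite /symfrac_scale mulrA -tofracM -scalerAl mul1r scalerA.
Qed.
Fact symfrac_scale1 : left_id 1 symfrac_scale.
Proof. by move=> v; rewrite /symfrac_scale /symfrac_scalar scale1r tofrac1 mul1r. Qed.
Fact symfrac_scaleDr : right_distributive symfrac_scale +%R.
Proof. by move=> c u v; rewrite /symfrac_scale mulrDr. Qed.
Fact symfrac_scaleDl v : {morph symfrac_scale^~ v : a b / a + b}.
Proof.
by move=> a b; rewrite /symfrac_scale /symfrac_scalar scalerDl tofracD mulrDl.
Qed.
HB.instance Definition _ := GRing.Zmodule_isLmodule.Build k symfrac
  symfrac_scaleA symfrac_scale1 symfrac_scaleDr symfrac_scaleDl.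
Fact symfrac_scaleAl (c : k) (u v : symfrac) : c *: (u * v) = (c *: u) * v.
Proof. exact: mulrA. Qed.
HB.instance Definition _ := GRing.Lmodule_isLalgebra.Build k symfrac
  symfrac_scaleAl.
HB.instance Definition _ := GRing.Lalgebra_isComAlgebra.Build k symfrac.

(* t_x, in Frac S(V). *)
Definition tfrac (x : V) : symfrac := tofrac (symvar x).
Lemma tfrac_is_linear : linear tfrac.
Proof.
move=> c x y; rewrite /tfrac.
have -> : symvar (c *: x + y) = c%:A * symvar x + symvar y.
  by rewrite mulr_algl linearP.
by rewrite tofracD tofracM.
Qed.
HB.instance Definition _ := GRing.isLinear.Build k V symfrac _ tfrac
  tfrac_is_linear.
End SymmetricAlgebra.

Section ConvolutionInverse.
Variables (k : fieldType) (H : fdHopfType k).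
Local Notation n := (\dim {:H}).
Local Notation K := (symfrac H).

(* t_{x_1} t^-1_{x_2} = t^-1_{x_1} t_{x_2} = eps(x) 1. *)
Definition is_tinv (f : {linear H -> K}) :=
  forall x : H,
    sweedler (comul x) (fun x1 x2 => tfrac x1 * f x2) = (counit x : k)%:A /\
    sweedler (comul x) (fun x1 x2 => f x1 * tfrac x2) = (counit x : k)%:A.

Definition conv (f g : H -> K) (x : H) : K :=
  sweedler (comul x) (fun x1 x2 => f x1 * g x2).
Let epsK (x : H) : K := (counit x : k)%:A.

Lemma conv_is_linear (f g : {linear H -> K}) : linear (conv f g).
Proof.
move=> c x y; rewrite /conv linearP sweedlerD; last by move=> *; rewrite linearD mulrDl.
rewrite /sweedler [in RHS]scaler_sumr; congr (_ + _); apply: eq_bigr => j _.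
rewrite scalerAl; congr (_ * _); rewrite -[RHS]linearZ_LR; congr (f _).
rewrite [RHS]scaler_sumr.
by apply: eq_bigr => i _; rewrite mxE scalerA.
Qed.

Lemma linear_eq_ebas (f g : H -> K) : linear f -> linear g ->
  (forall i, f (ebas i) = g (ebas i)) -> f =1 g.
Proof.
move=> fL gL fg x.
pose f' : {linear H -> K} := HB.pack f (GRing.isLinear.Build _ _ _ _ f fL).
pose g' : {linear H -> K} := HB.pack g (GRing.isLinear.Build _ _ _ _ g gL).
rewrite -[f]/(f' : H -> K) -[g]/(g' : H -> K) (ecrdK x) !linear_sum.
by apply: eq_bigr => i _; rewrite !linearZ /= fg.
Qed.

Lemma epsK_is_linear : linear epsK.
Proof. by move=> c x y; rewrite /epsK linearP scalerDl -scalerA. Qed.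

Lemma eq_conv (f f' g g' : H -> K) :
  f =1 f' -> g =1 g' -> conv f g =1 conv f' g'.
Proof. by move=> ff gg x; apply: eq_bigr => j _; rewrite ff gg. Qed.

Lemma conv_eps (f : {linear H -> K}) : conv f epsK =1 f.
Proof.
move=> x; rewrite -[in RHS](comul_counit x) /sweedler linear_sum.
by apply: eq_bigr => j _; rewrite linearZ /= mulr_algr.
Qed.

Lemma eps_conv (f : {linear H -> K}) : conv epsK f =1 f.
Proof.
move=> x; rewrite -[in RHS](counit_comul x) /sweedler linear_sum.
by apply: eq_bigr => j _; rewrite linearZ /= mulr_algl.
Qed.

Lemma convA (f g h : {linear H -> K}) :
  conv f (conv g h) =1 conv (conv f g) h.
Proof.
move=> x.
pose ev2 (z : tens H H) := sweedler z (fun a b => g a * h b).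
pose f3 a z := f a * ev2 z.
have gDl a a' b : g (a + a') * h b = g a * h b + g a' * h b.
  by rewrite linearD mulrDl.
have gDr a b b' : g a * h (b + b') = g a * h b + g a * h b'.
  by rewrite linearD mulrDr.
have gZ c a b : g (c *: a) * h b = g a * h (c *: b).
  by rewrite !linearZ /= -scalerAl scalerAr.
have ev2Z c z : ev2 (c *: z) = c *: ev2 z.
  rewrite /ev2 /sweedler [in RHS]scaler_sumr; apply: eq_bigr => j _.
  rewrite scalerAl; congr (_ * _); rewrite -[RHS]linearZ_LR; congr (g _).
rewrite [RHS]scaler_sumr.
  by apply: eq_bigr => i _; rewrite mxE scalerA.
have fDl a a' z : f3 (a + a') z = f3 a z + f3 a' z.
  by rewrite /f3 linearD mulrDl.
have fDr a z z' : f3 a (z + z') = f3 a z + f3 a z'.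
  by rewrite /f3 /ev2 (sweedlerD gDl) mulrDr.
have fZ c a z : f3 (c *: a) z = f3 a (c *: z).
  by rewrite /f3 ev2Z linearZ /= -scalerAl scalerAr.
have := congr1 (fun z => sweedler z f3) (comul_coassoc x).
rewrite [X in sweedler X]/sweedler (sweedler_sum fDl).
rewrite [X in _ = sweedler X _]/sweedler (sweedler_sum fDl).
under eq_bigr => j _ do rewrite (sweedler_tensor fDr fZ).
under [X in _ = X -> _]eq_bigr => j _.
  rewrite [X in sweedler X]/sweedler (sweedler_sum fDl).
  under eq_bigr => l _.
    rewrite (sweedler_tensor fDr fZ) /f3 /ev2.
    rewrite (sweedler_tensor gDr gZ) mulrA.
    over.
  rewrite -mulr_suml.
  over.
by [].
Qed.

Let Tp : 'M[symalg H]_n :=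
  \matrix_(i, j) symvar (\sum_l (comul (ebas i : H)) l j *: ebas l).
Let T : 'M[K]_n := map_mx (@tofrac (symalg H)) Tp.

Let convT (f : H -> K) i :
  conv (@tfrac k H) f (ebas i) = \sum_j T i j * f (ebas j).
Proof. by apply: eq_bigr => j _; rewrite !mxE. Qed.

Let T_unit : T \in unitmx.
Proof.
rewrite unitmxE unitfE det_map_mx tofrac_eq0.
have [g gE] := @symalg_lift k H k^o (@counit k H).
apply/eqP => /(congr1 g); rewrite raddf0 -det_map_mx.
suff -> : map_mx g Tp = 1%:M by rewrite det1; apply/eqP/oner_neq0.
apply/matrixP => i j; rewrite !mxE gE.
have H_eq := congr1 (ecrd j) (counit_comul (ebas i : H)).
rewrite ecrd_ebas in H_eq; rewrite eq_sym -H_eq.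
by rewrite [RHS]ecrd_sum.
Qed.

Let conv_inj (f g : {linear H -> K}) :
  conv (@tfrac k H) f =1 conv (@tfrac k H) g -> f =1 g.
Proof.
move=> fg; apply: linear_eq_ebas; [exact: linearP | exact: linearP |].
pose cv (f : H -> K) : 'cV[K]_n := \col_j f (ebas j).
suff : cv f = cv g by move=> /colP E i; have := E i; rewrite !mxE.
have TE h : T *m cv h = \col_i conv (@tfrac k H) h (ebas i).
  apply/colP => i; rewrite [LHS]mxE [RHS]mxE convT.
  by apply: eq_bigr => j _; congr (_ * _); rewrite mxE.
apply: (can_inj (mulKmx T_unit)); rewrite !TE.
by apply/colP => i; rewrite !mxE fg.
Qed.

Lemma tinv_exists : {f : {linear H -> K} | is_tinv f}.
Proof.
pose u : 'cV[K]_n := invmx T *m \col_i epsK (ebas i).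
pose f0 (x : H) : K := \sum_i ecrd i x *: u i 0.
have f0L : linear f0.
  move=> c x y; rewrite /f0 scaler_sumr -big_split /=.
  by apply: eq_bigr => i _; rewrite /ecrd linearP scalerDl scalerA.
pose f : {linear H -> K} := HB.pack f0 (GRing.isLinear.Build _ _ _ _ f0 f0L).
have fE i : f (ebas i) = u i 0.
  rewrite /= /f0 (bigD1 i) //= big1 => [|j nji].
    by rewrite ecrd_ebas eqxx scale1r addr0.
  by rewrite ecrd_ebas (negPf nji) scale0r.
have tf : conv (@tfrac k H) f =1 epsK.
  apply: linear_eq_ebas; [exact: conv_is_linear | exact: epsK_is_linear |].
  move=> i; rewrite convT; under eq_bigr do rewrite fE.
  have /colP/(_ i) : T *m u = \col_i epsK (ebas i) by rewrite mulKVmx.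
  by rewrite !mxE.
pose eL : {linear H -> K} :=
  HB.pack epsK (GRing.isLinear.Build _ _ _ _ epsK epsK_is_linear).
pose ft : {linear H -> K} := HB.pack (conv f (@tfrac k H))
  (GRing.isLinear.Build _ _ _ _ _ (conv_is_linear f (@tfrac k H))).
have ftE : ft =1 eL.
  apply: conv_inj => x; rewrite (convA _ f _ x).
  rewrite (eq_conv tf (frefl _)) (eps_conv (@tfrac k H) x).
  by rewrite (conv_eps (@tfrac k H) x).
by exists f => x; split; [exact: tf | exact: ftE].
Qed.

Lemma tinv_unique (f g : {linear H -> K}) : is_tinv f -> is_tinv g -> f =1 g.
Proof.
by move=> fP gP; apply: conv_inj => x; have [+ _] := fP x; have [+ _] := gP x;
  rewrite /conv => -> ->.
Qed.

(* The unique linear map x |-> t^-1_x, see [tinv_unique]. *)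
Definition tinv : {linear H -> K} := sval tinv_exists.
Lemma tinvP : is_tinv tinv. Proof. exact: (svalP tinv_exists). Qed.
End ConvolutionInverse.

Section GeneratedSubalgebra.
Variables (k : fieldType) (A : comAlgType k) (G : A -> Prop).

Inductive in_subalg : A -> Prop :=
| in_subalg_scalar c : in_subalg c%:A
| in_subalg_gen x of G x : in_subalg x
| in_subalg_add x y of in_subalg x & in_subalg y : in_subalg (x + y)
| in_subalg_mul x y of in_subalg x & in_subalg y : in_subalg (x * y).

Definition subalg_pred : {pred A} := fun x => `[< in_subalg x >].

Lemma subalg_predP x : reflect (in_subalg x) (x \in subalg_pred).
Proof. exact: asboolP. Qed.

Fact subalg_pred_closed : subalg_closed subalg_pred.
Proof.
split=> [|c x y /subalg_predP Ax /subalg_predP Ay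
         |x y /subalg_predP Ax /subalg_predP Ay]; apply/subalg_predP.
- by rewrite -[1]scale1r; apply: in_subalg_scalar.
- apply: in_subalg_add => //; rewrite -mulr_algl.
  by apply: in_subalg_mul => //; apply: in_subalg_scalar.
- exact: in_subalg_mul.
Qed.
HB.instance Definition _ := GRing.isSubalgClosed.Build k A subalg_pred
  subalg_pred_closed.

Record subalg := Subalg {subalg_val : A; _ : subalg_val \in subalg_pred}.
HB.instance Definition _ := [isSub for subalg_val].
HB.instance Definition _ := [Choice of subalg by <:].
HB.instance Definition _ := [SubChoice_isSubComNzRing of subalg by <:].
HB.instance Definition _ := [SubZmodule_isSubLmodule of subalg by <:].
HB.instance Definition _ :=
  [SubNzRing_SubLmodule_isSubLalgebra of subalg by <:].
HB.instance Definition _ := [SubLalgebra_isSubAlgebra of subalg by <:].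

Definition subalg_elt x (Gx : G x) : subalg :=
  Subalg (introT (subalg_predP x) (in_subalg_gen Gx)).

End GeneratedSubalgebra.

(* A itself, as a module by multiplication over its subalgebra generated by G. *)
Definition over_subalg (k : fieldType) (A : comAlgType k) (G : A -> Prop) :
  Type := A.

Section OverSubalgebra.
Variables (k : fieldType) (A : comAlgType k) (G : A -> Prop).
Local Notation subalg := (subalg G).
Local Notation over_subalg := (over_subalg G).

HB.instance Definition _ := GRing.Zmodule.copy over_subalg A.

Definition over_subalg_scale (b : subalg) (x : over_subalg) : over_subalg :=
  subalg_val b * x.
Fact over_subalg_scaleA b c x :
  over_subalg_scale b (over_subalg_scale c x) = over_subalg_scale (b * c) x.
Proof. exact: mulrA. Qed.
Fact over_subalg_scale1 : left_id 1 over_subalg_scale.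
Proof. by move=> x; exact: mul1r. Qed.
Fact over_subalg_scaleDr : right_distributive over_subalg_scale +%R.
Proof. by move=> b x y; exact: mulrDr. Qed.
Fact over_subalg_scaleDl x : {morph over_subalg_scale^~ x : b c / b + c}.
Proof. by move=> b c; exact: mulrDl. Qed.
HB.instance Definition _ := GRing.Zmodule_isLmodule.Build subalg over_subalg
  over_subalg_scaleA over_subalg_scale1 over_subalg_scaleDr over_subalg_scaleDl.

Lemma over_subalgE (b : subalg) (x : over_subalg) :
  b *: x = subalg_val b * (x : A).
Proof. by []. Qed.
End OverSubalgebra.

Section HopfAlgebras.
Variables (k : fieldType) (H : fdHopfType k).

Definition theta_gen (z : symfrac H) : Prop :=
  exists x : H, z = tfrac x \/ z = tinv H x.
Definition Stheta := subalg theta_gen.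
HB.instance Definition _ := GRing.ComAlgebra.on Stheta.

Definition ttheta (x : H) : Stheta :=
  subalg_elt (ex_intro _ x (or_introl erefl) : theta_gen (tfrac x)).
Definition ttheta_inv (x : H) : Stheta :=
  subalg_elt (ex_intro _ x (or_intror erefl) : theta_gen (tinv H x)).

(* t_{x_1} t_{y_1} t^-1_{x_2 y_2} and t_{x_1 y_1} t^-1_{x_2} t^-1_{y_2}. *)
Definition sigma (x y : H) : Stheta :=
  sweedler (comul x) (fun x1 x2 => sweedler (comul y) (fun y1 y2 =>
    ttheta x1 * ttheta y1 * ttheta_inv (x2 * y2))).
Definition sigma_inv (x y : H) : Stheta :=
  sweedler (comul x) (fun x1 x2 => sweedler (comul y) (fun y1 y2 =>
    ttheta (x1 * y1) * ttheta_inv x2 * ttheta_inv y2)).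

Definition BH_gen (z : Stheta) : Prop :=
  exists x y : H, z = sigma x y \/ z = sigma_inv x y.
Definition BH := subalg BH_gen.
HB.instance Definition _ := GRing.ComAlgebra.on BH.
Definition Stheta_BH := over_subalg BH_gen.
HB.instance Definition _ := GRing.Lmodule.on Stheta_BH.
End HopfAlgebras.

Section Modules.

Definition is_ideal (R : comNzRingType) (I : R -> Prop) : Prop :=
  [/\ I 0, forall x y, I x -> I y -> I (x + y) & forall a x, I x -> I (a * x)].

Definition noetherian (R : comNzRingType) : Prop :=
  forall I : R -> Prop, is_ideal I ->
  exists (n : nat) (s : 'I_n -> R),
  forall x, I x <-> exists c : 'I_n -> R, x = \sum_i c i * s i.

Variables (R : nzRingType) (M : lmodType R).

Definition finitely_generated : Prop :=
  exists (n : nat) (s : 'I_n -> M),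
  forall x, exists c : 'I_n -> R, x = \sum_i c i *: s i.

Definition projective : Prop :=
  forall (N P : lmodType R) (p : {linear N -> P}) (f : {linear M -> P}),
  (forall y, exists x, p x = y) ->
  exists g : {linear M -> N}, forall x, p (g x) = f x.

(* M is a generator of the category of R-modules: Hom(M, -) is faithful. *)
Definition generator : Prop :=
  forall (N P : lmodType R) (f g : {linear N -> P}),
  (forall (h : {linear M -> N}) x, f (h x) = g (h x)) -> f =1 g.

End Modules.

(* Main.v *)
Require Import Defs.
From mathcomp Require Import all_boot all_algebra.
From HB Require Import structures.
From mathcomp Require Import perm fraction mpoly boolp.

Set Implicit Arguments.
Unset Strict Implicit.
Unset Printing Implicit Defensive.

Import GRing.Theory.
Local Open Scope ring_scope.

(** Write [A] for the algebra generated by the [t_x] and [t^-1_x], [B] for the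
    subalgebra generated by the values of the cocycle [sigma] and of its
    inverse, [K] for the field of fractions, and let [e_i] be a basis of [H].

    The identity [t_x t_y = sigma(x_1, y_1) t_(x_2 y_2)] shows that the
    [B]-module generated by the [t_x] is a subalgebra, and likewise for the
    [t^-1_x]. The matrix of convolution with [t] has its entries in the first
    one and its inverse has its entries in the second, so the inverse of its
    determinant is integral over [B]; therefore it already belongs to the
    first subalgebra, which is thus equal to [A] ([tA_generates]). Being
    generated by finitely many elements, [B] is Noetherian by Hilbert's basis
    theorem ([BH_noetherian]).

    For projectivity, let [J] be the matrix over [k] whose rows are the
    coordinates of the elements [(e_i e_j - e_j e_i) e_l], let [r] be its rank
    and [Phi] the invertible matrix of convolution with [t]. Commutativity of
    [A] gives a matrix [M] over [B] of relations between the [t_(e_i)] such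
    that [P M Phi = J] for some matrix [P] over [A] ([commutator_relK]), so
    that the minors of order [r] of [M] generate the unit ideal of [A].
    Conversely, for every relation [v] over [B], the row [v Phi] belongs to the
    row space of [J] over [K] ([relation_comm_mx]): apply the coaction
    [t_x |-> t_(x_1) (x) x_2] with values in [K (x) Q], where [Q] is the largest
    commutative quotient of [H]; it fixes [B] because the
    projection of [H] onto [Q] is multiplicative. Hence over [K] the rows of [M] meeting a nonzero
    minor [d] of order [r] span all relations, and Cramer's rule produces
    [B]-linear forms [phi_i] on [A] such that
    [d x = \sum_i phi_i(x) t_(e_i)] for all [x] ([minor_dual_basis]). The
    factors [d] for which such forms exist are the members of an ideal of [B]
    which generates the unit ideal of [A]; by Nakayama's lemma it is the unit
    ideal ([unit_ideal_descent]), and [d = 1] is the dual basis that makes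
    [A] projective. The values of the forms [phi_i] generate an ideal that is
    again the unit ideal, because [1 = \sum_i phi_i(1) t_(e_i)]; this makes
    [A] a generator. *)

(** * Noetherian rings *)

Section Ideals.
Variable R : comNzRingType.
Implicit Types (G : seq R) (I : R -> Prop).

(** The ideal generated by the members of [G]. *)
Inductive idl G : R -> Prop :=
| idl_zero : idl G 0
| idl_step a g x of g \in G & idl G x : idl G (a * g + x).

Lemma idlD G x y : idl G x -> idl G y -> idl G (x + y).
Proof.
move=> Gx Gy; elim: Gx => [|a g z gG _ IH]; first by rewrite add0r.
by rewrite -addrA; apply: idl_step.
Qed.

Lemma idlM G a x : idl G x -> idl G (a * x).
Proof.
elim=> [|b g z gG _ IH]; first by rewrite mulr0; apply: idl_zero.
by rewrite mulrDr mulrA; apply: idl_step.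
Qed.

Lemma idl_sub G G' x : {subset G <= G'} -> idl G x -> idl G' x.
Proof.
move=> sGG'; elim=> [|a g z gG _ IH]; first exact: idl_zero.
by apply: idl_step => //; apply: sGG'.
Qed.

Lemma idl_ideal I G x :
  is_ideal I -> (forall g, g \in G -> I g) -> idl G x -> I x.
Proof.
by move=> [I0 ID IM] GI; elim=> // a g z gG _ Iz; apply: ID => //; apply/IM/GI.
Qed.

Lemma ideal_opp I x : is_ideal I -> I x -> I (- x).
Proof. by move=> [_ _ IM] Ix; rewrite -mulN1r; apply: IM. Qed.

Lemma ideal_sub I x y : is_ideal I -> I x -> I y -> I (x - y).
Proof.
by move=> idI Ix Iy; have [_ ID _] := idI; apply: ID => //; apply: ideal_opp.
Qed.

Lemma ideal_sum I (T : Type) (r : seq T) (P : pred T) F :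
  is_ideal I -> (forall i, P i -> I (F i)) -> I (\sum_(i <- r | P i) F i).
Proof. by move=> [I0 ID _] FI; apply: big_ind. Qed.

Lemma idlP G x :
  idl G x <-> exists c : 'I_(size G) -> R, x = \sum_i c i * G`_i.
Proof.
split=> [|[c ->]].
  elim=> [|a g z gG _ [c ->]].
    by exists (fun=> 0); rewrite big1 // => i _; rewrite mul0r.
  have gi : (index g G < size G)%N by rewrite index_mem.
  pose i0 := Ordinal gi.
  exists (fun i => (if i == i0 then a else 0) + c i).
  under [RHS]eq_bigr do rewrite mulrDl; rewrite big_split /=; congr (_ + _).
  rewrite (bigD1 i0) //= eqxx nth_index // big1 ?addr0 // => i /negPf->.
  by rewrite mul0r.
elim/big_ind: _ => [|x' y' Gx Gy|i _]; first exact: idl_zero.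
  exact: idlD.
by rewrite -[_ * _]addr0; apply: idl_step; [exact: mem_nth | exact: idl_zero].
Qed.

Lemma noetherianP : noetherian R <->
  forall I, is_ideal I -> exists G, forall x, I x <-> idl G x.
Proof.
split=> nR I /nR [] => [n [s sP]|G GP].
  exists [seq s i | i <- enum 'I_n] => x; rewrite sP; split=> [[c ->]|].
    elim/big_ind: _ => [|x' y' Gx Gy|i _]; first exact: idl_zero.
      exact: idlD.
    rewrite -[_ * _]addr0; apply: idl_step; last exact: idl_zero.
    by apply/mapP; exists i; rewrite ?mem_enum.
  elim=> [|a g z /mapP[i _ ->] _ [c ->]].
    by exists (fun=> 0); rewrite big1 // => i _; rewrite mul0r.
  exists (fun j => (if j == i then a else 0) + c j).
  under [RHS]eq_bigr do rewrite mulrDl; rewrite big_split /=; congr (_ + _).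
  by rewrite (bigD1 i) //= eqxx big1 ?addr0 // => j /negPf->; rewrite mul0r.
exists (size G), (fun i => G`_i) => x; rewrite GP; exact: idlP.
Qed.

End Ideals.

Lemma field_noetherian (F : fieldType) : noetherian F.
Proof.
apply/noetherianP => I [I0 ID IM].
have [[x [Ix nx]]|nI] := pselect (exists x, I x /\ x != 0).
  exists [:: x] => y; split=> [_|].
    rewrite -[y]addr0 -[y](divfK nx); apply: idl_step; rewrite ?inE //.
    exact: idl_zero.
  by apply: idl_ideal => // g; rewrite inE => /eqP->.
exists [::] => y; split=> [Iy|]; last by apply: idl_ideal.
have [->|ny] := eqVneq y 0; first exact: idl_zero.
by case: nI; exists y.
Qed.

Lemma noetherian_surj (R S : comNzRingType) (f : {rmorphism R -> S}) :
  (forall y, exists x, f x = y) -> noetherian R -> noetherian S.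
Proof.
move=> fsurj /noetherianP nR; apply/noetherianP => I idI.
have [I0 ID IM] := idI.
have [|G GP] := nR (fun x => I (f x)).
  by split=> [|x y|a x]; rewrite ?rmorph0 ?rmorphD ?rmorphM //;
    [apply: ID | apply: IM].
exists (map f G) => y; split=> [|].
  have [x <-] := fsurj y; move/GP.
  elim=> [|a g z gG _ IH]; first by rewrite rmorph0; apply: idl_zero.
  by rewrite rmorphD rmorphM; apply: idl_step => //; apply: map_f.
apply: idl_ideal => // _ /mapP[g gG ->]; apply/GP.
by rewrite -[g]addr0 -[g in g + 0]mul1r; apply: idl_step => //; exact: idl_zero.
Qed.

Section HilbertBasis.
Variable R : comNzRingType.
Hypothesis nR : noetherian R.
Variable I : {poly R} -> Prop.
Hypothesis idI : is_ideal I.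

(** Finite choice over the members of a sequence. *)
Lemma seq_choice (T U : eqType) (P : T -> U -> Prop) (s : seq T) :
  (forall a, a \in s -> exists p, P a p) ->
  exists r : seq U, (forall a, a \in s -> exists2 p, p \in r & P a p) /\
    (forall p, p \in r -> exists a, P a p).
Proof.
elim: s => [|a s IH] sP; first by exists [::].
have [|r [rP rQ]] := IH; first by move=> b bs; apply: sP; rewrite inE bs orbT.
have [p Pp] := sP a (mem_head _ _).
exists (p :: r); split=> [b|q]; rewrite inE => /predU1P[->|].
- by exists p; rewrite ?mem_head.
- by move=> /rP[q qr Pq]; exists q; rewrite // inE qr orbT.
- by exists a.
- exact: rQ.
Qed.

Lemma size_shift d e (p : {poly R}) : (d <= e)%N -> (size p <= d.+1)%N ->
  (size ('X^(e - d) * p)%R <= e.+1)%N.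
Proof.
move=> le_de sp; apply/leq_sizeP => j lt_ej; rewrite coefXnM; case: ltnP => // _.
by rewrite nth_default // (leq_trans sp) // ltn_subRL subnK.
Qed.

(** The coefficients in degree [d] of the members of [I] of degree at most
    [d]. *)
Definition lead_coefs d (a : R) :=
  exists p, [/\ I p, (size p <= d.+1)%N & p`_d = a].

Lemma lead_coefsS d e a : (d <= e)%N -> lead_coefs d a -> lead_coefs e a.
Proof.
have [_ _ IM] := idI.
move=> le_de [p [Ip sp pa]]; exists ('X^(e - d) * p); split; first exact: IM.
  exact: size_shift.
by rewrite coefXnM ltnNge leq_subr /= subKn.
Qed.

Lemma lead_coefs_ideal d : is_ideal (lead_coefs d).
Proof.
have [I0 ID IM] := idI; split=> [|x y [p [Ip sp px]] [q [Iq sq qy]]|a x [p [Ip sp px]]].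
- by exists 0; rewrite size_poly0 coef0.
- exists (p + q); rewrite coefD px qy; split=> //; first exact: ID.
  by rewrite (leq_trans (size_polyD p q)) // geq_max sp.
- exists (a%:P * p); rewrite coefCM px; split=> //; first exact: IM.
  by rewrite mul_polyC (leq_trans (size_scale_leq a p)).
Qed.

(** The ideals [lead_coefs d] are stationary: their union is finitely
    generated, and its generators occur in a common degree. *)
Lemma lead_coefs_top :
  exists D, forall d a, lead_coefs d a -> lead_coefs D a.
Proof.
have [|G GP] := (noetherianP R).1 nR (fun a => exists d, lead_coefs d a).
  split=> [|x y [d dx] [e ey]|a x [d dx]].
  - by exists 0; have [] := lead_coefs_ideal 0.
  - exists (maxn d e); have [_ LD _] := lead_coefs_ideal (maxn d e).
    by apply: LD; [apply: lead_coefsS dx; apply: leq_maxl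
                 | apply: lead_coefsS ey; apply: leq_maxr].
  - by exists d; have [_ _ LM] := lead_coefs_ideal d; apply: LM.
have [D DP] : exists D, forall a, a \in G -> lead_coefs D a.
  have {GP}: forall a, a \in G -> exists d, lead_coefs d a.
    move=> a aG; apply/GP; rewrite -[a]addr0 -[a in a + 0]mul1r.
    by apply: idl_step => //; exact: idl_zero.
  elim: (G) => [|a s IH] sP; first by exists 0.
  have [|D DP] := IH; first by move=> b bs; apply: sP; rewrite inE bs orbT.
  have [d da] := sP a (mem_head _ _).
  exists (maxn d D) => b; rewrite inE => /predU1P[->|/DP].
    by apply: lead_coefsS da; apply: leq_maxl.
  by apply: lead_coefsS; apply: leq_maxr.
exists D => d a da; have {da} : idl G a by apply/GP; exists d.
exact: idl_ideal (lead_coefs_ideal D) DP.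
Qed.

Lemma lead_coefs_gen d : exists G : seq {poly R},
  (forall g, g \in G -> I g) /\
  (forall a, lead_coefs d a ->
     exists q, [/\ idl G q, (size q <= d.+1)%N & q`_d = a]).
Proof.
have [G GP] := (noetherianP R).1 nR _ (lead_coefs_ideal d).
have [|r [rP rQ]] := @seq_choice R {poly R}
  (fun a p => [/\ I p, (size p <= d.+1)%N & p`_d = a]) G.
  move=> a aG; apply/GP; rewrite -[a]addr0 -[a in a + 0]mul1r.
  by apply: idl_step => //; exact: idl_zero.
exists r; split=> [g /rQ[a []] //|a /GP].
elim=> [|b g z gG _ [q [rq sq qz]]].
  by exists 0; rewrite size_poly0 coef0; split=> //; exact: idl_zero.
have [p pr [_ sp pg]] := rP g gG.
exists (b%:P * p + q); rewrite coefD coefCM pg qz; split=> //.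
  exact: idl_step.
rewrite (leq_trans (size_polyD _ _)) // geq_max sq andbT.
by rewrite mul_polyC (leq_trans (size_scale_leq _ _)).
Qed.

(** Generators of [I] come from generators of the ideals [lead_coefs d] for
    [d <= D], with [D] as in [lead_coefs_top]: subtracting a combination of
    them lowers the degree of any member of [I]. *)
Lemma Hilbert_basis_ideal : exists G, forall p, I p <-> idl G p.
Proof.
have [D DP] := lead_coefs_top; have [I0 ID IM] := idI.
have [G [GI GP]] : exists G : seq {poly R}, (forall g, g \in G -> I g) /\
  (forall d a, (d <= D)%N -> lead_coefs d a ->
     exists q, [/\ idl G q, (size q <= d.+1)%N & q`_d = a]).
  elim: (D) => [|m [G [GI GP]]].
    have [G [GI GP]] := lead_coefs_gen 0.
    by exists G; split=> // d a; rewrite leqn0 => /eqP->; apply: GP.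
  have [G' [GI' GP']] := lead_coefs_gen m.+1.
  exists (G ++ G'); split=> [g|d a].
    by rewrite mem_cat => /orP[/GI|/GI'].
  rewrite leq_eqVlt => /predU1P[->|le_dm].
    move=> /GP'[q [Gq sq qa]]; exists q; split=> //.
    by apply: idl_sub Gq => g gG; rewrite mem_cat gG orbT.
  move=> /(GP _ _ le_dm)[q [Gq sq qa]]; exists q; split=> //.
  by apply: idl_sub Gq => g gG; rewrite mem_cat gG.
have step d p : I p -> (size p <= d.+1)%N ->
    exists q, [/\ idl G q, (size q <= d.+1)%N & q`_d = p`_d].
  move=> Ip sp; have Lp : lead_coefs d p`_d by exists p.
  have [le_dD|/ltnW le_Dd] := leqP d D; first exact: GP.
  have [q [Gq sq qa]] := GP D _ (leqnn D) (DP _ _ Lp).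
  exists ('X^(d - D) * q); split; first exact: idlM.
    exact: size_shift.
  by rewrite coefXnM ltnNge leq_subr /= subKn.
exists G => p; split; last exact: idl_ideal.
have [d] := ubnP (size p); elim: d => // d IH in p *; rewrite ltnS => sp Ip.
case: d => [|d] in IH sp *.
  by move: sp; rewrite leqn0 size_poly_eq0 => /eqP->; exact: idl_zero.
have [q [Gq sq qp]] := step d p Ip sp.
rewrite -[p](subrK q); apply: idlD => //; apply: IH; last first.
  by apply: ideal_sub => //; apply: idl_ideal Gq.
rewrite ltnS; apply/leq_sizeP => j; rewrite leq_eqVlt => /predU1P[<-|lt_dj].
  by rewrite coefB qp subrr.
by rewrite coefB !nth_default ?subrr // (leq_trans _ lt_dj).
Qed.

End HilbertBasis.

Theorem Hilbert_basis (R : comNzRingType) : noetherian R -> noetherian {poly R}.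
Proof. by move=> nR; apply/noetherianP => I; apply: Hilbert_basis_ideal. Qed.

(** A finitely generated commutative algebra over a field is a quotient of an
    iterated polynomial ring. *)
Lemma noetherian_cover (F : fieldType) (A : comNzRingType)
    (i : {rmorphism F -> A}) (s : seq A) :
  exists (P : comNzRingType) (g : {rmorphism P -> A}),
    [/\ noetherian P, forall c, exists p, g p = i c &
        forall x, x \in s -> exists p, g p = x].
Proof.
elim: s => [|x s [P [g [nP gF gs]]]].
  by exists F, i; split=> [|c|//]; [exact: field_noetherian | exists c].
pose h : {rmorphism {poly P} -> A} := horner_morph (fun p => mulrC x (g p)).
exists {poly P}, h; split=> [|c|y]; first exact: Hilbert_basis.
  by have [p <-] := gF c; exists p%:P; apply: horner_morphC.
rewrite inE => /predU1P[->|/gs[p <-]]; first by exists 'X; apply: horner_morphX.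
by exists p%:P; apply: horner_morphC.
Qed.

(** * Determinants *)

Section Minors.
Variable R : comNzRingType.

(** Expansion of the determinant of a product along the rows of the left
    factor. *)
Lemma det_mulmx_rows (r N : nat) (X : 'M[R]_(r, N)) (M : 'M[R]_(N, r)) :
  \det (X *m M) =
  \sum_(f : {ffun 'I_r -> 'I_N}) (\prod_i X i (f i)) * \det (rowsub f M).
Proof.
rewrite /determinant.
transitivity (\sum_(s : 'S_r) \sum_(f : {ffun 'I_r -> 'I_N})
   (-1) ^+ s * ((\prod_i X i (f i)) * \prod_i M (f i) (s i))).
  apply: eq_bigr => s _; rewrite -big_distrr /=; congr (_ * _).
  under eq_bigr do rewrite mxE.
  by rewrite bigA_distr_bigA /=; apply: eq_bigr => f _; rewrite big_split.
rewrite exchange_big; apply: eq_bigr => f _; rewrite big_distrr.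
apply: eq_bigr => s _; rewrite mulrCA; congr (_ * (_ * _)).
by apply: eq_bigr => i _; rewrite mxE.
Qed.

(** A weak form of the Cauchy-Binet formula: minors with repeated rows or
    columns, which vanish, are kept. *)
Lemma det_mulmx_minors (r N n : nat) (X : 'M[R]_(r, N)) (M : 'M[R]_(N, n))
    (Y : 'M[R]_(n, r)) :
  \det (X *m M *m Y) =
  \sum_(p : {ffun 'I_r -> 'I_N} * {ffun 'I_r -> 'I_n})
    (\prod_i X i (p.1 i)) * (\prod_i Y (p.2 i) i) * \det (mxsub p.1 p.2 M).
Proof.
rewrite -mulmxA det_mulmx_rows.
rewrite -(pair_bigA _ (fun (f : {ffun 'I_r -> 'I_N}) (g : {ffun 'I_r -> 'I_n}) =>
  (\prod_i X i (f i)) * (\prod_i Y (g i) i) * \det (mxsub f g M))) /=.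
apply: eq_bigr => f _.
rewrite -det_tr rowsubE mulmxA -rowsubE trmx_mul det_mulmx_rows mulr_sumr.
apply: eq_bigr => g _; rewrite -mulrA; congr (_ * (_ * _)).
  by apply: eq_bigr => i _; rewrite mxE.
by rewrite -[RHS]det_tr; congr (\det _); apply/matrixP => i j; rewrite !mxE.
Qed.

Lemma det_cong_ideal (I : R -> Prop) n (M M' : 'M[R]_n) : is_ideal I ->
  (forall i j, I (M i j - M' i j)) -> I (\det M - \det M').
Proof.
move=> idI MM'; have [I0 ID IM] := idI.
rewrite -sumrB; apply: ideal_sum => // s _; rewrite -mulrBr; apply/IM.
apply: (big_ind2 (fun x y => I (x - y))) => [|x x' y y' Ix Iy|//].
  by rewrite subrr.
rewrite (_ : x * y - x' * y' = y * (x - x') + x' * (y - y')).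
  by apply/ID; apply/IM.
by rewrite !mulrBr [y * x]mulrC [y * x']mulrC addrA subrK.
Qed.

End Minors.

(** * Modules generated by finitely many elements *)

Section FiniteExtension.
Variables (B A : comNzRingType) (iota : {rmorphism B -> A}).
Hypothesis iota_inj : injective iota.
Variables (n : nat) (t : 'I_n -> A).
Hypothesis t_gen : forall x, exists v : 'I_n -> B, x = \sum_i iota (v i) * t i.

(** Nakayama's lemma: an ideal of [B] that generates the unit ideal of the
    finite extension [A] is the unit ideal. *)
Lemma unit_ideal_descent (I : B -> Prop) (S : finType) (d : S -> B)
    (a : S -> A) :
  is_ideal I -> (forall s, I (d s)) -> \sum_s iota (d s) * a s = 1 -> I 1.
Proof.
move=> idI Id d1; have [I0 ID IM] := idI.
have [c cE] : exists c : 'I_n -> S -> 'I_n -> B,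
    forall l s, a s * t l = \sum_p iota (c l s p) * t p.
  have cE l s : exists c : 'I_n -> B, a s * t l = \sum_p iota (c p) * t p.
    exact: t_gen.
  have {}cE l := boolp.choice (cE l).
  by exists (fun l => projT1 (cE l)) => l s; exact: (projT2 (cE l)).
(* [C] has its entries in [I] and fixes [T], so that [det(1 - C)], which is
   congruent to [1] modulo [I], annihilates [A]. *)
pose C : 'M[B]_n := \matrix_(l, p) \sum_s d s * c l s p.
pose T : 'cV[A]_n := \col_l t l.
have CT : map_mx iota C *m T = T.
  apply/colP => l; rewrite !mxE -[RHS]mul1r -d1 mulr_suml.
  under eq_bigr do rewrite !mxE rmorph_sum mulr_suml.
  rewrite exchange_big; apply: eq_bigr => s _ /=.
  rewrite -mulrA cE mulr_sumr; apply: eq_bigr => p _.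
  by rewrite rmorphM mulrA.
have detT l : iota (\det (1%:M - C)) * t l = 0.
  have: (iota (\det (1%:M - C)))%:M *m T = 0.
    rewrite -det_map_mx -mul_adj_mx -mulmxA map_mxB map_mx1 mulmxBl mul1mx CT.
    by rewrite subrr mulmx0.
  by move/colP/(_ l); rewrite mul_scalar_mx !mxE.
have det0 : \det (1%:M - C) = 0.
  apply: iota_inj; rewrite rmorph0 -[LHS]mulr1; have [v ->] := t_gen 1.
  by rewrite mulr_sumr big1 // => l _; rewrite mulrCA detT mulr0.
rewrite -[1](subr0 1) -det0 -[X in X - _](det1 _ n).
apply: det_cong_ideal => // i j; rewrite !mxE opprB addrC subrK.
by apply: ideal_sum => // s _; rewrite mulrC; apply: IM.
Qed.

(** A dual basis of the [B]-module [A] relative to the generators [t], up to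
    the factor [b]. *)
Definition dual_basis (b : B) (phi : A -> 'I_n -> B) :=
  (forall c x y i, phi (iota c * x + y) i = c * phi x i + phi y i) /\
  (forall x, iota b * x = \sum_i iota (phi x i) * t i).

Definition has_dual_basis b := exists phi, dual_basis b phi.

Lemma dual_basis_ideal : is_ideal has_dual_basis.
Proof.
split=> [|b c [f [fL fE]] [g [gL gE]]|a b [f [fL fE]]].
- exists (fun _ _ => 0); split=> [*|x]; first by rewrite mulr0 addr0.
  by rewrite /= rmorph0 mul0r big1 // => i _; rewrite mul0r.
- exists (fun x i => f x i + g x i); split=> [e x y i|x].
    by rewrite fL gL mulrDr addrACA.
  rewrite rmorphD mulrDl fE gE -big_split.
  by apply: eq_bigr => i _; rewrite rmorphD mulrDl.
- exists (fun x i => a * f x i); split=> [e x y i|x].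
    by rewrite fL mulrDr mulrCA.
  rewrite rmorphM -mulrA fE mulr_sumr.
  by apply: eq_bigr => i _; rewrite rmorphM mulrA.
Qed.

Section ConstantRank.
Variables (K : fieldType) (kappa : {rmorphism A -> K}).
Hypothesis kappa_inj : injective kappa.
(** The matrix [M] collects relations between the generators [t]. Its rank is
    at least [r] at every point of the spectrum of [A], by [XMY], and at most
    [r] at the generic point, by [rel_J] and [rank_J]. *)
Variables (N r : nat) (Phi : 'M[K]_n) (J : 'M[K]_(N, n)) (M : 'M[B]_(N, n)).
Variables (X : 'M[A]_(r, N)) (Y : 'M[A]_(n, r)).
Hypothesis rank_J : (\rank J <= r)%N.
Hypothesis Phi_unit : Phi \in unitmx.
Hypothesis M_rel : map_mx iota M *m (\col_i t i) = 0.
Hypothesis rel_J : forall v : 'rV[B]_n, map_mx iota v *m (\col_i t i) = 0 ->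
  (map_mx (kappa \o iota) v *m Phi <= J)%MS.
Hypothesis XMY : X *m map_mx iota M *m Y = 1%:M.

Let j : {rmorphism B -> K} := kappa \o iota.
Let j_inj : injective j. Proof. exact: inj_comp. Qed.
Let T : 'cV[A]_n := \col_i t i.

(** Every minor of maximal order [r] of the relation matrix [M] has a dual
    basis: over the field [K] the rows of [M] meeting a nonzero minor span all
    the relations, and on the complementary columns Cramer's rule yields
    coordinates. *)
Lemma minor_dual_basis (f : 'I_r -> 'I_N) (g : 'I_r -> 'I_n) :
  has_dual_basis (\det (mxsub f g M)).
Proof.
set M1 := mxsub f g M; set b := \det M1.
have [b0|nb] := eqVneq b 0.
  by rewrite b0; have [] := dual_basis_ideal.
pose M' := rowsub f M.
pose G : 'M[B]_(n, r) := colsub g 1%:M.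
(* By Cramer's rule [M' E = 0] and [E t = b t]; the coordinates of [x], once
   multiplied by [E], no longer depend on their choice. *)
pose E : 'M[B]_n := b%:M - G *m \adj M1 *m M'.
have M'G : M' *m G = M1.
  rewrite /G mulmx_colsub mulmx1.
  by apply/matrixP => i l; rewrite !mxE.
have M'E : M' *m E = 0.
  rewrite mulmxBr 2!mulmxA M'G mul_mx_adj mul_scalar_mx.
  by rewrite scalar_mxC mul_scalar_mx subrr.
have M'T : map_mx iota M' *m T = 0.
  by rewrite /M' map_mxsub mul_rowsub_mx M_rel; apply/matrixP => i l; rewrite !mxE.
have ET : map_mx iota E *m T = iota b *: T.
  rewrite map_mxB mulmxBl map_scalar_mx mul_scalar_mx 2!map_mxM -!mulmxA M'T.
  by rewrite !mulmx0 subr0.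
have M1_unit : map_mx j M1 \in unitmx.
  by rewrite unitmxE det_map_mx unitfE -(rmorph0 j) (inj_eq j_inj).
have M'J : (map_mx j M' *m Phi :=: J)%MS.
  apply/eqmxP; have sM'J : (map_mx j M' *m Phi <= J)%MS.
    apply/row_subP => i; rewrite row_mul -map_row; apply: rel_J.
    by rewrite map_row -row_mul M'T row0.
  have /leqifP := mxrank_leqif_eq sM'J; case: ifP => // _.
  rewrite ltnNge => /negP[]; apply: (leq_trans rank_J).
  rewrite mxrankMfree ?row_free_unit //.
  rewrite -[X in (X <= _)%N](mxrank_unit M1_unit) -M'G map_mxM.
  exact: mxrankM_maxl.
have relE (v : 'rV[B]_n) : map_mx iota v *m T = 0 -> v *m E = 0.
  move=> /rel_J; rewrite -M'J => /submxP[w]; rewrite mulmxA.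
  move=> /(can_inj (mulmxK Phi_unit)) vE; rewrite -/j in vE.
  have /matrixP vE0 : map_mx j (v *m E) = 0.
    by rewrite map_mxM /= vE -mulmxA -map_mxM M'E map_mx0 mulmx0.
  apply/matrixP => p l; apply: j_inj.
  by have := vE0 p l; rewrite mxE => ->; rewrite !mxE rmorph0.
have [c cE] := boolp.choice t_gen.
pose coords x : 'rV[B]_n := \row_i c x i.
have coordsP x : (map_mx iota (coords x) *m T) 0 0 = x.
  by rewrite [RHS]cE mxE; apply: eq_bigr => i _; rewrite !mxE.
exists (fun x i => (coords x *m E) 0 i); split=> [e x y i|x].
  have /relE : map_mx iota (coords (iota e * x + y) - (e *: coords x + coords y))
      *m T = 0.
    rewrite map_mxB map_mxD map_mxZ mulmxBl mulmxDl -scalemxAl.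
    move: (_ *m T) (_ *m T) (_ *m T) (coordsP (iota e * x + y)) (coordsP x)
      (coordsP y) => P Q S PE QE SE.
    by apply/matrixP => p q; rewrite !ord1 !mxE PE QE SE subrr.
  rewrite mulmxBl mulmxDl -scalemxAl => /rowP/(_ i)/eqP.
  by rewrite !mxE subr_eq0 => /eqP.
have /matrixP/(_ 0 0) : map_mx iota (coords x *m E) *m T
    = iota b *: (map_mx iota (coords x) *m T).
  by rewrite map_mxM -mulmxA ET -scalemxAr.
rewrite [X in _ = X -> _]mxE coordsP => <-; rewrite mxE.
by apply: eq_bigr => i _; rewrite !mxE.
Qed.

(** The minors of order [r] of [M] generate the unit ideal of [A], because
    [X M Y = 1]. *)
Theorem dual_basis1 : has_dual_basis 1.
Proof.
have := det_mulmx_minors X (map_mx iota M) Y; rewrite XMY det1 => D1.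
apply: (unit_ideal_descent dual_basis_ideal
  (fun p : {ffun 'I_r -> 'I_N} * {ffun 'I_r -> 'I_n} =>
     minor_dual_basis p.1 p.2)).
rewrite [RHS]D1; apply: eq_bigr => p _.
by rewrite -map_mxsub det_map_mx mulrC.
Qed.

End ConstantRank.

(** If [A] has a dual basis, its trace ideal is the unit ideal. *)
Lemma dual_basis_trace (phi : A -> 'I_n -> B) : dual_basis 1 phi ->
  exists s : seq (A * 'I_n), \sum_(p <- s) phi p.1 p.2 = 1.
Proof.
move=> [phiL phiE].
have phiZ c x l : phi (iota c * x) l = c * phi x l.
  have := phiL 0 0 0 l; rewrite mulr0 addr0 mul0r add0r.
  have := phiL c x 0 l; rewrite addr0 => ->.
  have -> : phi 0 l = 0.
    by have := phiL (-1) 0 0 l; rewrite mulr0 addr0 mulN1r addNr.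
  by rewrite addr0.
pose I b := exists s : seq (A * 'I_n), \sum_(p <- s) phi p.1 p.2 = b.
have idI : is_ideal I.
  split=> [|b c [s <-] [s' <-]|c b [s <-]]; first by exists [::]; rewrite big_nil.
    by exists (s ++ s'); rewrite big_cat.
  exists [seq (iota c * p.1, p.2) | p <- s]; rewrite big_map mulr_sumr.
  by apply: eq_bigr => p _; rewrite phiZ.
apply: (unit_ideal_descent (d := phi 1) (a := t) idI).
  by move=> l; exists [:: (1, l)]; rewrite big_seq1.
by rewrite -phiE mulr1 rmorph1.
Qed.

End FiniteExtension.

(** * Convolution in coordinates *)

Lemma sum_prod (R : comNzRingType) (I J : finType) (F : I -> R) (G : J -> R) :
  \sum_(p : I * J) F p.1 * G p.2 = (\sum_i F i) * (\sum_j G j).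
Proof. by rewrite big_distrlr pair_big. Qed.

Lemma sum_pair (R : nmodType) (I J : finType) (F : I * J -> R) :
  \sum_p F p = \sum_i \sum_j F (i, j).
Proof. by rewrite pair_bigA; apply: eq_bigr => -[]. Qed.

Lemma sum_enum_val (R : nmodType) (T : finType) (F : T -> R) :
  \sum_(i < #|{: T}|) F (enum_val i) = \sum_x F x.
Proof. by rewrite -big_enum_val; apply: eq_bigl. Qed.

(** A coalgebra structure on the free [k]-module with basis [I]: the
    comultiplication and the counit in coordinates, so that
    [Delta(e_i) = \sum_(a, b) cd i a b e_a (x) e_b]. *)
Record coalg (k : comNzRingType) (I : finType) := Coalg {
  cd : I -> I -> I -> k;
  ce : I -> k;
  cd_coassoc : forall i a b c,
    \sum_s cd i a s * cd s b c = \sum_s cd i s c * cd s a b;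
  ce_cd : forall i b, \sum_a ce a * cd i a b = (i == b)%:R;
  cd_ce : forall i a, \sum_b cd i a b * ce b = (i == a)%:R
}.

(** The coordinate matrix [phi] defines a morphism of coalgebras. *)
Definition coalg_mor (k : comNzRingType) (I J : finType) (C : coalg k I)
    (D : coalg k J) (phi : I -> J -> k) :=
  (forall i a b, \sum_j phi i j * cd D j a b =
     \sum_p \sum_q cd C i p q * (phi p a * phi q b)) /\
  (forall i, \sum_j phi i j * ce D j = ce C i).

(** The tensor product of two coalgebras, on the product basis. *)
Section TensorCoalgebra.
Variables (k : comNzRingType) (I J : finType) (C : coalg k I) (D : coalg k J).

Let d (p q r : I * J) := cd C p.1 q.1 r.1 * cd D p.2 q.2 r.2.
Let e (p : I * J) := ce C p.1 * ce D p.2.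

Let dA p a b c : \sum_s d p a s * d s b c = \sum_s d p s c * d s a b.
Proof.
rewrite /d; under eq_bigr do rewrite mulrACA.
under [RHS]eq_bigr do rewrite mulrACA.
rewrite (sum_prod (fun s => cd C p.1 a.1 s * cd C s b.1 c.1)
  (fun s => cd D p.2 a.2 s * cd D s b.2 c.2)) !cd_coassoc -sum_prod.
by [].
Qed.

Let ed p b : \sum_a e a * d p a b = (p == b)%:R.
Proof.
rewrite /d /e; under eq_bigr do rewrite mulrACA.
rewrite (sum_prod (fun a => ce C a * cd C p.1 a b.1)
  (fun a => ce D a * cd D p.2 a b.2)) !ce_cd -natrM mulnb.
by case: p b => [? ?] [? ?].
Qed.

Let de p a : \sum_b d p a b * e b = (p == a)%:R.
Proof.
rewrite /d /e; under eq_bigr do rewrite mulrACA.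
rewrite (sum_prod (fun b => cd C p.1 a.1 b * ce C b)
  (fun b => cd D p.2 a.2 b * ce D b)) !cd_ce -natrM mulnb.
by case: p a => [? ?] [? ?].
Qed.

Definition ctens : coalg k (I * J)%type := Coalg dA ed de.
End TensorCoalgebra.

(** Composition of linear maps given by their coordinates. *)
Definition mor_comp (k : comNzRingType) (I J L : finType) (phi : I -> J -> k)
  (psi : J -> L -> k) i l := \sum_j phi i j * psi j l.

(** The linear map [phi (x) id] in coordinates. *)
Definition mor_tens_id (k : comNzRingType) (I I' J : finType)
  (phi : I -> I' -> k) (p : I * J) (q : I' * J) :=
  phi p.1 q.1 * (p.2 == q.2)%:R.

Section Morphisms.
Variable k : comNzRingType.

Lemma sum_deltal (J : finType) (R : nzRingType) (j : J) (F : J -> R) :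
  \sum_l (j == l)%:R * F l = F j.
Proof.
rewrite (bigD1 j) //= eqxx mul1r big1 ?addr0 // => l /negPf nlj.
by rewrite eq_sym nlj mul0r.
Qed.

Lemma mor_comp_coalg (I J L : finType) (C : coalg k I) (D : coalg k J)
    (E : coalg k L) phi psi :
  coalg_mor C D phi -> coalg_mor D E psi -> coalg_mor C E (mor_comp phi psi).
Proof.
move=> [phid phie] [psid psie]; split=> [i a b|i]; last first.
  rewrite -phie; under [RHS]eq_bigr do rewrite -psie mulr_sumr.
  rewrite exchange_big; apply: eq_bigr => l _; rewrite mulr_suml.
  by apply: eq_bigr => j _; rewrite mulrA.
transitivity (\sum_j phi i j * \sum_l psi j l * cd E l a b).
  under [RHS]eq_bigr do rewrite mulr_sumr.
  rewrite exchange_big; apply: eq_bigr => l _; rewrite mulr_suml.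
  by apply: eq_bigr => j _; rewrite mulrA.
transitivity (\sum_p \sum_q (\sum_j phi i j * cd D j p q) * (psi p a * psi q b)).
  under eq_bigr do rewrite psid mulr_sumr.
  rewrite exchange_big; apply: eq_bigr => p _.
  under eq_bigr do rewrite mulr_sumr.
  rewrite exchange_big; apply: eq_bigr => q _; rewrite mulr_suml.
  by apply: eq_bigr => j _; rewrite mulrA.
under eq_bigr => p _ do under eq_bigr => q _ do rewrite phid mulr_suml.
transitivity (\sum_p \sum_q \sum_p' \sum_q'
   cd C i p' q' * ((phi p' p * psi p a) * (phi q' q * psi q b))).
  apply: eq_bigr => p _; apply: eq_bigr => q _; apply: eq_bigr => p' _.
  rewrite mulr_suml; apply: eq_bigr => q' _.
  by rewrite -mulrA; congr (_ * _); rewrite mulrACA.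
rewrite exchange_big; under eq_bigr do rewrite exchange_big.
rewrite exchange_big; apply: eq_bigr => p' _ /=.
under eq_bigr => q _ do rewrite exchange_big.
rewrite exchange_big; apply: eq_bigr => q' _ /=.
rewrite /mor_comp mulr_suml mulr_sumr exchange_big; apply: eq_bigr => p _ /=.
by rewrite !mulr_sumr; apply: eq_bigr => q _.
Qed.

Lemma mor_tens_id_coalg (I I' J : finType) (C : coalg k I) (C' : coalg k I')
    (D : coalg k J) phi :
  coalg_mor C C' phi ->
  coalg_mor (ctens C D) (ctens C' D) (mor_tens_id phi).
Proof.
move=> [phid phie]; split=> [[i j] [a a'] [b b']|[i j]]; rewrite /mor_tens_id /=.
  under eq_bigr do rewrite mulrACA.
  rewrite (sum_prod (fun s => phi i s * cd C' s a b)
    (fun s => (j == s)%:R * cd D s a' b')) phid sum_deltal.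
  transitivity (\sum_(p : I * J)
      (\sum_q cd C i p.1 q * (phi p.1 a * phi q b)) *
      (\sum_q cd D j p.2 q * ((p.2 == a')%:R * (q == b')%:R))); last first.
    apply: eq_bigr => p _; rewrite -sum_prod; apply: eq_bigr => q _ /=.
    by rewrite mulrACA; congr (_ * _); rewrite mulrACA.
  rewrite (sum_prod (fun p => \sum_q cd C i p q * (phi p a * phi q b))
    (fun p => \sum_q cd D j p q * ((p == a')%:R * (q == b')%:R))).
  congr (_ * _); under eq_bigr => p _.
    under eq_bigr => q _ do rewrite mulrC -mulrA.
    rewrite -mulr_sumr [p == _]eq_sym.
    under eq_bigr do rewrite [_ == b']eq_sym.
    rewrite sum_deltal; over.
  by rewrite sum_deltal.
under eq_bigr do rewrite mulrACA.
rewrite (sum_prod (fun s => phi i s * ce C' s)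
    (fun s => (j == s)%:R * ce D s)) phie sum_deltal.
by [].
Qed.

End Morphisms.

Section Convolution.
Variables (k R : comNzRingType) (iota : {rmorphism k -> R}).

(** The convolution product of two linear maps to [R], each given by its
    values on the basis: [(f * g)(x) = f(x_1) g(x_2)]. *)
Definition cconv (I : finType) (C : coalg k I) (f g : I -> R) (i : I) : R :=
  \sum_a \sum_b iota (cd C i a b) * (f a * g b).

(** The counit with values in [R], which is the unit of convolution. *)
Definition ceps (I : finType) (C : coalg k I) (i : I) : R := iota (ce C i).

(** The composite [f \o phi] of linear maps given on the bases. *)
Definition pull (I J : finType) (phi : I -> J -> k) (f : J -> R) (i : I) : R :=
  \sum_j iota (phi i j) * f j.

(** The linear map [x (x) y |-> f(x) g(y)]. *)
Definition tensf (I J : finType) (f : I -> R) (g : J -> R) (p : I * J) : R :=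
  f p.1 * g p.2.

Section OneCoalgebra.
Variables (I : finType) (C : coalg k I).
Implicit Types f g h : I -> R.

Lemma cconvA f g h : cconv C f (cconv C g h) = cconv C (cconv C f g) h.
Proof.
apply: funext => i.
transitivity (\sum_a \sum_b \sum_c
    iota (\sum_s cd C i a s * cd C s b c) * (f a * (g b * h c))).
  apply: eq_bigr => a _.
  under eq_bigr => s _ do rewrite !mulr_sumr.
  rewrite exchange_big; apply: eq_bigr => b _ /=.
  under eq_bigr => s _ do rewrite !mulr_sumr.
  rewrite exchange_big; apply: eq_bigr => c _ /=.
  rewrite rmorph_sum mulr_suml; apply: eq_bigr => s _.
  by rewrite rmorphM -!mulrA; congr (_ * _); rewrite mulrCA.
under eq_bigr => a _ do under eq_bigr => b _ do
  under eq_bigr => c _ do rewrite cd_coassoc.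
symmetry; rewrite /cconv exchange_big /=.
under eq_bigr => c _.
  under eq_bigr => s _ do rewrite mulr_suml mulr_sumr.
  rewrite exchange_big /=; under eq_bigr => a _.
    under eq_bigr => s _ do rewrite mulr_suml mulr_sumr.
    rewrite exchange_big /=.
    over.
  over.
rewrite exchange_big; apply: eq_bigr => a _ /=.
rewrite exchange_big; apply: eq_bigr => b _ /=.
apply: eq_bigr => c _; rewrite rmorph_sum mulr_suml; apply: eq_bigr => s _.
by rewrite rmorphM -!mulrA.
Qed.

Lemma cconv_epsl f : cconv C (ceps C) f = f.
Proof.
apply: funext => i; rewrite /cconv exchange_big /= -[RHS](sum_deltal i f).
apply: eq_bigr => b _.
rewrite -(rmorph_nat iota) -(ce_cd C i b) rmorph_sum mulr_suml.
by apply: eq_bigr => a _; rewrite rmorphM mulrA [iota _ * iota _]mulrC.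
Qed.

Lemma cconv_epsr f : cconv C f (ceps C) = f.
Proof.
apply: funext => i; rewrite /cconv -[RHS](sum_deltal i f).
apply: eq_bigr => a _.
rewrite -(rmorph_nat iota) -(cd_ce C i a) rmorph_sum mulr_suml.
by apply: eq_bigr => b _; rewrite rmorphM -!mulrA [f a * _]mulrC.
Qed.

Lemma cconv_sumr (T : finType) f (F : T -> I -> R) (c : T -> R) i :
  cconv C f (fun a => \sum_s F s a * c s) i = \sum_s cconv C f (F s) i * c s.
Proof.
under [RHS]eq_bigr do rewrite mulr_suml.
rewrite exchange_big; apply: eq_bigr => a _ /=.
under [RHS]eq_bigr do rewrite mulr_suml.
rewrite exchange_big; apply: eq_bigr => b _ /=.
by rewrite !mulr_sumr; apply: eq_bigr => s _; rewrite !mulrA.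
Qed.

Lemma cconvBr f g h i :
  cconv C f (fun a => g a - h a) i = cconv C f g i - cconv C f h i.
Proof.
rewrite -sumrB; apply: eq_bigr => a _; rewrite -sumrB; apply: eq_bigr => b _.
by rewrite !mulrBr.
Qed.

(** The coordinate function of the basis element [c]. *)
Definition delta (c i : I) : R := (i == c)%:R.

Lemma sum_delta (f : I -> R) i : \sum_c delta c i * f c = f i.
Proof. exact: sum_deltal. Qed.

Lemma cconv_delta f g i :
  cconv C f g i = \sum_b cconv C f (delta b) i * g b.
Proof.
rewrite -cconv_sumr; congr (cconv _ _ _ i); apply: funext => b.
by rewrite sum_delta.
Qed.

(** Convolution commutes with the automorphisms of [C] that permute the
    basis. *)
Lemma cconv_reindex (s : I -> I) f g i : bijective s ->
  (forall i a b, cd C (s i) (s a) (s b) = cd C i a b) ->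
  cconv C (f \o s) (g \o s) i = cconv C f g (s i).
Proof.
move=> bs sd; rewrite /cconv [RHS](reindex s) /=; last exact: onW_bij.
apply: eq_bigr => a _; rewrite [RHS](reindex s) /=; last exact: onW_bij.
by apply: eq_bigr => b _; rewrite sd.
Qed.

End OneCoalgebra.

Lemma pull_conv (I J : finType) (C : coalg k I) (D : coalg k J) phi f g :
  coalg_mor C D phi ->
  pull phi (cconv D f g) = cconv C (pull phi f) (pull phi g).
Proof.
move=> [phid _]; apply: funext => i; rewrite /pull /cconv.
under eq_bigr => j _.
  rewrite mulr_sumr; under eq_bigr => a _.
    rewrite mulr_sumr; under eq_bigr => b _ do rewrite mulrA -rmorphM.
    over.
  over.
rewrite exchange_big /=.
transitivity (\sum_a \sum_b
  iota (\sum_j phi i j * cd D j a b) * (f a * g b)).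
  apply: eq_bigr => a _; rewrite exchange_big; apply: eq_bigr => b _ /=.
  by rewrite rmorph_sum mulr_suml.
transitivity (\sum_a \sum_b \sum_p \sum_q
  iota (cd C i p q * (phi p a * phi q b)) * (f a * g b)).
  apply: eq_bigr => a _; apply: eq_bigr => b _.
  rewrite phid rmorph_sum mulr_suml; apply: eq_bigr => p _.
  by rewrite rmorph_sum mulr_suml.
under [LHS]eq_bigr => a _ do rewrite exchange_big.
rewrite exchange_big; apply: eq_bigr => p _ /=.
under [LHS]eq_bigr => a _ do rewrite exchange_big.
rewrite exchange_big; apply: eq_bigr => q _ /=.
rewrite mulr_suml mulr_sumr; apply: eq_bigr => a _.
rewrite !mulr_sumr; apply: eq_bigr => b _.
by rewrite !rmorphM -!mulrA; congr (_ * (_ * _)); rewrite mulrCA.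
Qed.

Lemma pull_eps (I J : finType) (C : coalg k I) (D : coalg k J) phi :
  coalg_mor C D phi -> pull phi (ceps D) = ceps C.
Proof.
move=> [_ phie]; apply: funext => i; rewrite /ceps -phie rmorph_sum.
by apply: eq_bigr => j _; rewrite rmorphM.
Qed.

Lemma pull_deltaE (I J : finType) (phi : I -> J -> k) j i :
  pull phi (delta j) i = iota (phi i j).
Proof.
rewrite /pull (bigD1 j) //= /delta eqxx mulr1 big1 ?addr0 // => l /negPf nlj.
by rewrite nlj mulr0.
Qed.

Lemma pull_delta (I J : finType) (phi : I -> J -> k) f i :
  pull phi f i = \sum_j pull phi (delta j) i * f j.
Proof. by apply: eq_bigr => j _; rewrite pull_deltaE. Qed.

Lemma pull_comp (I J L : finType) (phi : I -> J -> k) (psi : J -> L -> k) f :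
  pull (mor_comp phi psi) f = pull phi (pull psi f).
Proof.
apply: funext => i; rewrite /pull /mor_comp.
under eq_bigr do rewrite rmorph_sum mulr_suml.
rewrite exchange_big; apply: eq_bigr => j _ /=.
by rewrite mulr_sumr; apply: eq_bigr => l _; rewrite rmorphM mulrA.
Qed.

Lemma pull_tens_id (I I' J : finType) (phi : I -> I' -> k) f (g : J -> R) :
  pull (mor_tens_id phi) (tensf f g) = tensf (pull phi f) g.
Proof.
apply: funext => p; rewrite /pull /tensf /mor_tens_id.
under eq_bigr do rewrite rmorphM mulrACA rmorph_nat.
by rewrite (sum_prod (fun a => iota (phi p.1 a) * f a)
  (fun b => (p.2 == b)%:R * g b)) sum_deltal.
Qed.

Lemma cconv_tens (I J : finType) (C : coalg k I) (D : coalg k J) f f' g g' :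
  cconv (ctens C D) (tensf f g) (tensf f' g') =
  tensf (cconv C f f') (cconv D g g').
Proof.
apply: funext => p; rewrite /cconv /tensf /= -sum_prod; apply: eq_bigr => a _.
rewrite -sum_prod; apply: eq_bigr => b _ /=.
by rewrite rmorphM [f _ * _ * _]mulrACA [LHS]mulrACA.
Qed.

Lemma tens_eps (I J : finType) (C : coalg k I) (D : coalg k J) :
  tensf (ceps C) (ceps D) = ceps (ctens C D).
Proof. by apply: funext => p; rewrite /ceps rmorphM. Qed.

End Convolution.

Section BaseChange.
Variables (k R R' : comNzRingType) (iota : {rmorphism k -> R}).
Variables (iota' : {rmorphism k -> R'}) (h : {rmorphism R -> R'}).
Hypothesis h_iota : forall c, h (iota c) = iota' c.

Lemma cconv_map (I : finType) (C : coalg k I) f g i :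
  h (cconv iota C f g i) = cconv iota' C (h \o f) (h \o g) i.
Proof.
rewrite rmorph_sum; apply: eq_bigr => a _; rewrite rmorph_sum.
by apply: eq_bigr => b _; rewrite !rmorphM h_iota.
Qed.

Lemma pull_map (I J : finType) (phi : I -> J -> k) f i :
  h (pull iota phi f i) = pull iota' phi (h \o f) i.
Proof. by rewrite rmorph_sum; apply: eq_bigr => j _; rewrite rmorphM h_iota. Qed.

Lemma tensf_map (I J : finType) (f : I -> R) (g : J -> R) :
  h \o tensf f g = tensf (h \o f) (h \o g).
Proof. by apply: funext => p; apply: rmorphM. Qed.

Lemma delta_map (I : finType) (c : I) : h \o delta R c = delta R' c.
Proof. by apply: funext => i; apply: rmorph_nat. Qed.

End BaseChange.

(** * Cocycles of convolution-invertible maps *)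

Section Cocycle.
Variables (k R : comNzRingType) (iota : {rmorphism k -> R}).
Variables (I : finType) (C : coalg k I) (m : I * I -> I -> k).
Hypothesis m_mor : coalg_mor (ctens C C) C m.

Local Notation C2 := (ctens C C).
Local Notation C3 := (ctens C2 C).
Local Notation cconv := (cconv iota).
Local Notation pull := (pull iota).
Local Notation eps := (ceps iota).

(** [cocycle t t'] is [(x, y) |-> t_(x_1) t_(y_1) t'_(x_2 y_2)] and
    [cocycle_inv t t'] is [(x, y) |-> t_(x_1 y_1) t'_(x_2) t'_(y_2)]. *)
Definition cocycle (t t' : I -> R) := cconv C2 (tensf t t) (pull m t').
Definition cocycle_inv (t t' : I -> R) := cconv C2 (pull m t) (tensf t' t').

(** The threefold multiplication [e_a (x) e_b (x) e_c |-> e_a e_b e_c]. *)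
Definition m3 : (I * I) * I -> I -> k := mor_comp (mor_tens_id m) m.

Lemma m3_mor : coalg_mor C3 C m3.
Proof. by apply: mor_comp_coalg m_mor; apply: mor_tens_id_coalg. Qed.

(** The exchange of the first two tensor factors. *)
Definition swap (p : (I * I) * I) := ((p.1.2, p.1.1), p.2).

Lemma swapK : involutive swap. Proof. by case=> [[]]. Qed.

Lemma swap_cd i a b : cd C3 (swap i) (swap a) (swap b) = cd C3 i a b.
Proof. by rewrite /= [cd C i.1.2 _ _ * _]mulrC. Qed.

Section Invertible.
Variables t t' : I -> R.
Hypothesis t't : cconv C t' t = eps C.

(** [t_x t_y = cocycle(x_1, y_1) t_(x_2 y_2)]. *)
Lemma cocycleK : cconv C2 (cocycle t t') (pull m t) = tensf t t.
Proof.
by rewrite -cconvA -(pull_conv _ _ _ m_mor) t't (pull_eps _ m_mor) cconv_epsr.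
Qed.

(** [t'_x t'_y = t'_(x_1 y_1) cocycle_inv(x_2, y_2)]. *)
Lemma cocycle_invK : cconv C2 (pull m t') (cocycle_inv t t') = tensf t' t'.
Proof.
by rewrite cconvA -(pull_conv _ _ _ m_mor) t't (pull_eps _ m_mor) cconv_epsl.
Qed.

Let ttt := tensf (tensf t t) t.
Let ttt' := tensf (tensf t' t') t'.

(** [t_x t_y t_z = cocycle3(x_1, y_1, z_1) t_(x_2 y_2 z_2)]. *)
Definition cocycle3 := cconv C3 ttt (pull m3 t').

(** The map [cocycle3] is a polynomial in the values of [cocycle]. *)
Lemma cocycle3E : cocycle3 =
  cconv C3 (tensf (cocycle t t') (eps C)) (pull (mor_tens_id m) (cocycle t t')).
Proof.
have m1_mor := mor_tens_id_coalg C m_mor.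
rewrite /cocycle (pull_conv _ _ _ m1_mor) -pull_comp -/m3 pull_tens_id.
rewrite -[eps C in RHS](cconv_epsl iota C) -cconv_tens cconvA -[X in cconv C3 X _]cconvA.
rewrite cconv_tens -(pull_conv _ _ _ m_mor) t't (pull_eps _ m_mor) cconv_epsl.
by rewrite cconv_tens cconv_epsl cconv_epsr.
Qed.

Lemma cocycle3K : cconv C3 cocycle3 (pull m3 t) = ttt.
Proof.
by rewrite -cconvA -(pull_conv _ _ _ m3_mor) t't (pull_eps _ m3_mor) cconv_epsr.
Qed.

(** The relations
    [cocycle3(x_1, y_1, z_1) t_(x_2 y_2 z_2) = cocycle3(y_1, x_1, z_1) t_(y_2 x_2 z_2)]
    with [t] replaced by [g]. *)
Definition commutator_rel (g : I -> R) i :=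
  cconv C3 cocycle3 (pull m3 g) i - cconv C3 cocycle3 (pull m3 g) (swap i).

(** The values of [g] on the elements [(xy - yx)z]. *)
Definition commutator_val (g : I -> R) i := pull m3 g i - pull m3 g (swap i).

Lemma commutator_rel0 i : commutator_rel t i = 0.
Proof.
rewrite /commutator_rel cocycle3K /ttt /tensf /= [t i.1.2 * _]mulrC.
exact: subrr.
Qed.

Lemma commutator_rel_delta g i :
  commutator_rel g i = \sum_p commutator_rel (@delta R I p) i * g p.
Proof.
under eq_bigr do rewrite mulrBl; rewrite sumrB -!cconv_sumr.
by rewrite /commutator_rel (funext (pull_delta iota m3 g)).
Qed.

Lemma commutator_rel_conv g :
  commutator_rel (cconv C t g) = cconv C3 ttt (commutator_val g).
Proof.
apply: funext => i; rewrite /commutator_rel (pull_conv _ _ _ m3_mor).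
rewrite cconvA cocycle3K cconvBr; congr (_ - _).
rewrite -(cconv_reindex _ _ _ _ (inv_bij swapK) swap_cd).
by congr (cconv _ _ _ i); apply: funext => j; rewrite /ttt /tensf /= [t j.1.2 * _]mulrC.
Qed.

(** Up to the convolution-invertible factors [t] and [t (x) t (x) t], the
    twisted commutators are the commutators. *)
Lemma commutator_relK g :
  cconv C3 ttt' (commutator_rel (cconv C t g)) = commutator_val g.
Proof.
rewrite commutator_rel_conv cconvA !cconv_tens t't.
by rewrite 2!tens_eps cconv_epsl.
Qed.

End Invertible.

(** Twisting [t] by an algebra map [pi] with convolution inverse [pi'] leaves
    the cocycle unchanged. *)
Section Twist.
Variables t t' pi pi' : I -> R.
Hypothesis tt' : cconv C t t' = eps C.
Hypothesis pipi' : cconv C pi pi' = eps C.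
Hypothesis piM : pull m pi = tensf pi pi.
Let rho := cconv C t pi.
Let rho' := cconv C pi' t'.

Lemma twistK : cconv C rho rho' = eps C.
Proof. by rewrite cconvA -[X in cconv C X _]cconvA pipi' cconv_epsr tt'. Qed.

Lemma twist_cocycle : cocycle rho rho' = cocycle t t'.
Proof.
rewrite /cocycle -cconv_tens (pull_conv _ _ _ m_mor) cconvA -[X in cconv C2 X _]cconvA.
by rewrite -piM -(pull_conv _ _ _ m_mor) pipi' (pull_eps _ m_mor) cconv_epsr.
Qed.

Lemma twist_cocycle_inv : cocycle_inv rho rho' = cocycle_inv t t'.
Proof.
rewrite /cocycle_inv -cconv_tens (pull_conv _ _ _ m_mor) cconvA -[X in cconv C2 X _]cconvA.
by rewrite piM cconv_tens pipi' tens_eps cconv_epsr.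
Qed.

End Twist.
End Cocycle.

Section CocycleBaseChange.
Variables (k R R' : comNzRingType) (iota : {rmorphism k -> R}).
Variables (iota' : {rmorphism k -> R'}) (h : {rmorphism R -> R'}).
Hypothesis h_iota : forall c, h (iota c) = iota' c.
Variables (I : finType) (C : coalg k I) (m : I * I -> I -> k).

Lemma cocycle_map t t' p : h (cocycle iota C m t t' p) =
  cocycle iota' C m (h \o t) (h \o t') p.
Proof.
rewrite (cconv_map h_iota) tensf_map; congr (cconv _ _ _ _ p).
by apply: funext => q; apply: pull_map.
Qed.

Lemma cocycle_inv_map t t' p : h (cocycle_inv iota C m t t' p) =
  cocycle_inv iota' C m (h \o t) (h \o t') p.
Proof.
rewrite (cconv_map h_iota) tensf_map; congr (cconv _ _ _ _ p).
by apply: funext => q; apply: pull_map.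
Qed.

End CocycleBaseChange.

(** * Inverses of integral elements *)

(** If the inverse [y] of [theta] stabilises a finitely generated
    [B]-submodule that contains [1], then [y] is integral over [B], and
    therefore belongs to [B[theta]], hence to every subring [P] that contains
    [B] and [theta]. *)
Lemma integral_inverse (B A : comNzRingType) (iota : {rmorphism B -> A})
    (n : nat) (u : 'I_n -> A) (c : 'M[B]_n) (w : 'I_n -> B) (theta y : A)
    (P : A -> Prop) :
  (forall i, y * u i = \sum_l iota (c i l) * u l) ->
  1 = \sum_l iota (w l) * u l ->
  theta * y = 1 ->
  (forall b, P (iota b)) -> P theta ->
  (forall x z, P x -> P z -> P (x + z)) ->
  (forall x z, P x -> P z -> P (x * z)) ->
  P y.
Proof.
move=> yu u1 thy PB Pth PD PM.
have P0 : P 0 by rewrite -(rmorph0 iota).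
have [n0|n_gt0] := posnP n.
  suff -> : y = 0 by [].
  by rewrite -[y]mulr1 u1 big1 ?mulr0 // => l; have := ltn_ord l; rewrite {2}n0.
pose U : 'cV[A]_n := \col_l u l.
pose p := char_poly c.
have yU : (y%:M - map_mx iota c) *m U = 0.
  apply/colP => i; rewrite mulmxBl mul_scalar_mx !mxE yu -sumrB big1 // => l _.
  by rewrite !mxE subrr.
have py : (map_poly iota p).[y] = 0.
  have ev : (map_poly iota p).[y] = \det (y%:M - map_mx iota c).
    rewrite /p map_char_poly -[LHS]/(horner_eval y _) -det_map_mx.
    congr (\det _); apply/matrixP => i l; rewrite !mxE /= /horner_eval.
    by rewrite hornerD hornerN hornerC hornerMn hornerX.
  have detU l : (map_poly iota p).[y] * u l = 0.
    have: ((map_poly iota p).[y])%:M *m U = 0.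
      by rewrite ev -mul_adj_mx -mulmxA yU mulmx0.
    by move/colP/(_ l); rewrite mul_scalar_mx !mxE.
  rewrite -[LHS]mulr1 [X in _ * X]u1 mulr_sumr big1 // => l _.
  by rewrite mulrCA detU mulr0.
have pE : \sum_(i < n.+1) iota p`_i * y ^+ i = 0.
  rewrite -[RHS]py (horner_coef_wide y (n := n.+1)).
    by apply: eq_bigr => i _; rewrite coef_map.
  by rewrite -(size_char_poly c); apply: size_poly.
have pn : p`_n = 1.
  by have := char_poly_monic c; rewrite monicE lead_coefE size_char_poly => /eqP.
(* Multiplying the equation of integral dependence by [theta ^+ n.-1] expresses
   [y] as a polynomial in [theta]. *)
have yn : y ^+ n = - \sum_(i < n) iota p`_i * y ^+ i.
  apply/eqP; rewrite -addr_eq0 addrC; apply/eqP.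
  by rewrite -[RHS]pE big_ord_recr /= pn rmorph1 mul1r.
have thyX i : theta ^+ i * y ^+ i = 1 by rewrite -exprMn thy expr1n.
have -> : y = \sum_(i < n) iota (- p`_i) * theta ^+ (n.-1 - i).
  transitivity (theta ^+ n.-1 * y ^+ n).
    by rewrite -[in X in _ * X](prednK n_gt0) exprSr mulrA thyX mul1r.
  rewrite yn -sumrN mulr_sumr; apply: eq_bigr => i _.
  have le_in : (i <= n.-1)%N by rewrite -ltnS prednK.
  rewrite rmorphN mulrN mulNr mulrCA; congr (- (_ * _)).
  by rewrite -[in LHS](subnK le_in) exprD -mulrA thyX mulr1.
elim/big_ind: _ => // i _; apply/PM => //.
by elim: (_ - _)%N => [|e IH]; rewrite ?expr0 -?(rmorph1 iota) // exprS; apply/PM.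
Qed.

(** * Extending a ring morphism to fractions *)

Section Localisation.
Variables (S : idomainType) (R : comNzRingType) (f : {rmorphism S -> R}).
Local Notation K := {fraction S}.

(** [frac_graph a y]: the fraction [a] has a denominator that [f] maps to a
    unit, and the extension of [f] to such fractions maps [a] to [y]. *)
Definition frac_graph (a : K) (y : R) := exists p s : S,
  [/\ s != 0, exists u, f s * u = 1, a * tofrac s = tofrac p & f p = f s * y].

Lemma frac_graph_fun a y y' : frac_graph a y -> frac_graph a y' -> y = y'.
Proof.
move=> [p [s [_ [u su] ap fp]]] [p' [s' [_ [u' su'] ap' fp']]].
have ps : p * s' = p' * s.
  by apply/eqP; rewrite -tofrac_eq; apply/eqP; rewrite !tofracM -ap -ap' mulrAC.
have /(congr1 (fun z => u * u' * z)) : f s * f s' * y = f s * f s' * y'.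
  by rewrite mulrAC -fp -[LHS]rmorphM ps rmorphM fp' mulrAC [f s' * _]mulrC.
have uu : u * u' * (f s * f s') = 1.
  by rewrite mulrACA [u * _]mulrC su [u' * _]mulrC su' mulr1.
by move: uu; move: (u * u') (f s * f s') => v w vw; rewrite !mulrA vw !mul1r.
Qed.

Lemma frac_graph_tofrac p : frac_graph (tofrac p) (f p).
Proof.
exists p, 1; rewrite oner_neq0 rmorph1 tofrac1 mulr1 mul1r; split=> //.
by exists 1; rewrite mulr1.
Qed.

Lemma frac_graphD a y a' y' :
  frac_graph a y -> frac_graph a' y' -> frac_graph (a + a') (y + y').
Proof.
move=> [p [s [ns [u su] ap fp]]] [p' [s' [ns' [u' su'] ap' fp']]].
exists (p * s' + p' * s), (s * s'); split.
- by rewrite mulf_neq0.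
- by exists (u * u'); rewrite rmorphM mulrACA su su' mulr1.
- rewrite tofracD !tofracM -ap -ap' mulrDl mulrA; congr (_ + _).
  by rewrite [tofrac s * _]mulrC mulrA.
- by rewrite rmorphD !rmorphM fp fp' mulrDr mulrAC; congr (_ + _);
    rewrite mulrC mulrA.
Qed.

Lemma frac_graphM a y a' y' :
  frac_graph a y -> frac_graph a' y' -> frac_graph (a * a') (y * y').
Proof.
move=> [p [s [ns [u su] ap fp]]] [p' [s' [ns' [u' su'] ap' fp']]].
exists (p * p'), (s * s'); split.
- by rewrite mulf_neq0.
- by exists (u * u'); rewrite rmorphM mulrACA su su' mulr1.
- by rewrite !tofracM -ap -ap' mulrACA.
- by rewrite !rmorphM fp fp' mulrACA.
Qed.

Lemma frac_graph0 : frac_graph 0 0.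
Proof. by rewrite -tofrac0 -(rmorph0 f); apply: frac_graph_tofrac. Qed.

Lemma frac_graph_sum (T : finType) (F : T -> K) (G : T -> R) :
  (forall i, frac_graph (F i) (G i)) ->
  frac_graph (\sum_i F i) (\sum_i G i).
Proof.
move=> FG; apply: (big_ind2 frac_graph); first exact: frac_graph0.
  by move=> *; apply: frac_graphD.
by move=> i _.
Qed.

End Localisation.

(** * Commutative rings generated by commuting elements *)

Section DoubleCommutant.
Variables (R : nzRingType) (G : R -> Prop).

(** [commuting]: the elements of [G] commute pairwise; [commutant y]: [y]
    commutes with the elements of [G]. *)
Definition commuting := forall x y, G x -> G y -> x * y = y * x.
Definition commutant (y : R) := forall g, G g -> y * g = g * y.

Definition double_commutant_pred : {pred R} :=
  fun x => `[< forall y, commutant y -> x * y = y * x >].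

Lemma double_commutantP x :
  reflect (forall y, commutant y -> x * y = y * x) (x \in double_commutant_pred).
Proof. exact: asboolP. Qed.

Fact double_commutant_subring : subring_closed double_commutant_pred.
Proof.
split=> [|x y /double_commutantP xC /double_commutantP yC
         |x y /double_commutantP xC /double_commutantP yC].
- by apply/double_commutantP => y _; rewrite mul1r mulr1.
- by apply/double_commutantP => z Cz; rewrite mulrBl mulrBr xC ?yC.
- by apply/double_commutantP => z Cz; rewrite -mulrA yC // mulrA xC // mulrA.
Qed.
HB.instance Definition _ := GRing.isSubringClosed.Build R double_commutant_pred
  double_commutant_subring.

Lemma double_commutant_comm x y : commuting ->
  x \in double_commutant_pred -> y \in double_commutant_pred -> x * y = y * x.
Proof.
move=> GC /double_commutantP xC /double_commutantP yC; apply: xC => g Gg.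
by apply: yC => g' Gg'; apply: GC.
Qed.

(** The double commutant of a commuting set [G] is a commutative ring that
    contains [G] and the centre of [R]. *)
Record double_commutant (GC : commuting) := DoubleCommutant {
  dc_val : R; _ : dc_val \in double_commutant_pred }.

Variable GC : commuting.
Local Notation D := (double_commutant GC).
HB.instance Definition _ := [isSub for @dc_val GC].
HB.instance Definition _ := [Choice of D by <:].
HB.instance Definition _ := [SubChoice_isSubNzRing of D by <:].
Fact double_commutant_mulC : commutative (@GRing.mul D).
Proof.
by move=> [x xP] [y yP]; apply: val_inj; apply: double_commutant_comm.
Qed.
HB.instance Definition _ := GRing.PzRing_hasCommutativeMul.Build D
  double_commutant_mulC.

End DoubleCommutant.

(** * Finite-dimensional Hopf algebras in coordinates *)

Section Coordinates.
Variables (k : fieldType) (H : fdHopfType k).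
Local Notation n := (\dim {:H}).
Local Notation I := 'I_n.
Local Notation e := (@ebas k H).
Local Notation K := (symfrac H).

Lemma ecrd_is_linear (V : vectType k) i : linear_for *%R (@ecrd k V i).
Proof. by move=> c x y; rewrite /ecrd linearP. Qed.

Lemma ecrd_suml (V : vectType k) (T : finType) (F : T -> V) i :
  ecrd i (\sum_s F s) = \sum_s ecrd i (F s).
Proof. exact: linear_sum. Qed.

Lemma ecrdZ (V : vectType k) c (x : V) i : ecrd i (c *: x) = c * ecrd i x.
Proof. exact: linearZ. Qed.

Lemma sweedler_coord (U : lmodType k) (z : tens H H) (f : H -> H -> U) :
  (forall w, linear (f^~ w)) ->
  sweedler z f = \sum_a \sum_b z a b *: f (e a) (e b).
Proof.
move=> fL; rewrite exchange_big; apply: eq_bigr => b _ /=.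
pose g : {linear H -> U} :=
  HB.pack (f^~ (e b)) (GRing.isLinear.Build _ _ _ _ (f^~ (e b)) (fL (e b))).
rewrite -[LHS]/(g _) linear_sum; apply: eq_bigr => a _; exact: linearZ.
Qed.

(** The comultiplication, the counit and the multiplication of [H] in the
    canonical basis. *)
Definition hD (i a b : I) : k := comul (e i) a b.
Definition hE (i : I) : k := counit (e i).
Definition hM (p : I * I) (l : I) : k := ecrd l (e p.1 * e p.2).

Lemma hMulE i j : e i * e j = \sum_l hM (i, j) l *: e l.
Proof. exact: ecrdK. Qed.

Lemma comul_coord (x : H) a b : comul x a b = \sum_i ecrd i x * hD i a b.
Proof.
rewrite {1}(ecrdK x) linear_sum summxE; apply: eq_bigr => i _.
by rewrite linearZ mxE.
Qed.

Let crdK a (x : H) : K := (ecrd a x)%:A.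
Let crdK_linear a : linear (crdK a).
Proof. by move=> c x y; rewrite /crdK ecrd_is_linear scalerDl scalerA. Qed.
HB.instance Definition _ a :=
  GRing.isLinear.Build k H K _ (crdK a) (crdK_linear a).

(** Coassociativity is tested on the coordinate functions. *)
Lemma hDA i a b c :
  \sum_s hD i a s * hD s b c = \sum_s hD i s c * hD s a b.
Proof.
apply: (fmorph_inj (in_alg K)).
have := @Defs.convA k H (crdK a) (crdK b) (crdK c) (e i).
have convE (f g : {linear H -> K}) x : Defs.conv f g x =
    \sum_p \sum_q (comul x p q) *: (f (e p) * g (e q)).
  by apply: sweedler_coord => w r y z; rewrite linearP mulrDl -scalerAl.
have crd2 p q x : Defs.conv (crdK p) (crdK q) x = (comul x p q)%:A.
  rewrite convE (bigD1 p) //= (bigD1 q) //= /crdK !ecrd_ebas !eqxx.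
  rewrite !scale1r mulr1 [X in _ + X + _]big1 ?addr0 => [|s /negPf ns]; last first.
    by rewrite ecrd_ebas eq_sym ns scale0r mulr0 scaler0.
  rewrite big1 ?addr0 // => s /negPf ns; rewrite big1 // => r _.
  by rewrite ecrd_ebas eq_sym ns scale0r mul0r scaler0.
have crdE p s : crdK p (e s) = ((p == s)%:R)%:A by rewrite /crdK ecrd_ebas.
rewrite [X in X = _](_ : _ = (\sum_s hD i a s * hD s b c)%:A); last first.
  transitivity (\sum_p \sum_q (comul (e i) p q) *:
      (crdK a (e p) * Defs.conv (crdK b) (crdK c) (e q))).
    apply: sweedler_coord => w r y z.
    by rewrite linearP mulrDl -scalerAl.
  rewrite (bigD1 a) //= [X in _ + X]big1 ?addr0 => [|s /negPf ns]; last first.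
    rewrite big1 // => q _; rewrite crdE eq_sym ns scale0r mul0r scaler0 //.
  rewrite scaler_suml; apply: eq_bigr => s _.
  by rewrite crd2 crdE eqxx scale1r mul1r scalerA.
rewrite [X in _ = X -> _](_ : _ = (\sum_s hD i s c * hD s a b)%:A); last first.
  transitivity (\sum_p \sum_q (comul (e i) p q) *:
      (Defs.conv (crdK a) (crdK b) (e p) * crdK c (e q))).
    apply: sweedler_coord => w r y z.
    by rewrite (conv_is_linear (crdK a) (crdK b)) mulrDl -scalerAl.
  rewrite exchange_big (bigD1 c) //= [X in _ + X]big1 ?addr0 => [|s /negPf ns]; last first.
    by rewrite big1 // => q _; rewrite crdE eq_sym ns scale0r mulr0 scaler0.
  rewrite scaler_suml; apply: eq_bigr => s _.
  by rewrite crd2 crdE eqxx scale1r mulr1 scalerA.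
by [].
Qed.

Lemma hED i b : \sum_a hE a * hD i a b = (i == b)%:R.
Proof.
have := congr1 (ecrd b) (counit_comul (e i)).
rewrite ecrd_ebas eq_sym => <-; rewrite sweedler_coord => [|w c x y]; last by rewrite linearP scalerDl scalerA.
rewrite ecrd_suml; apply: eq_bigr => a _; rewrite ecrd_suml (bigD1 b) //=.
rewrite !ecrdZ ecrd_ebas eqxx mulr1 mulrC big1 ?addr0 // => s /negPf ns.
by rewrite !ecrdZ ecrd_ebas eq_sym ns !mulr0.
Qed.

Lemma hDE i a : \sum_b hD i a b * hE b = (i == a)%:R.
Proof.
have := congr1 (ecrd a) (comul_counit (e i)).
rewrite ecrd_ebas eq_sym => <-; rewrite sweedler_coord => [|w c x y]; last first.
  by rewrite scalerDr !scalerA mulrC.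
rewrite exchange_big ecrd_suml; apply: eq_bigr => b _; rewrite ecrd_suml (bigD1 a) //=.
rewrite !ecrdZ ecrd_ebas eqxx mulr1 big1 ?addr0 // => s /negPf ns.
by rewrite !ecrdZ ecrd_ebas eq_sym ns !mulr0.
Qed.

(** The coalgebra [H] in the canonical basis. *)
Definition hC : coalg k I := Coalg hDA hED hDE.

Lemma hM_mor : coalg_mor (ctens hC hC) hC hM.
Proof.
split=> [[i j] a b|[i j]] /=; last first.
  rewrite /hE -counitM hMulE linear_sum; apply: eq_bigr => l _.
  by rewrite linearZ.
transitivity (comul (e i * e j) a b); first by rewrite comul_coord.
rewrite comulM sweedler_coord => [|w c x y]; last first.
  rewrite /sweedler scaler_sumr -big_split; apply: eq_bigr => s _ /=.
  by rewrite mulrDl -scalerAl tensorDl tensorZl.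
rewrite summxE.
transitivity (\sum_p \sum_q \sum_r \sum_s
  hD i p q * hD j r s * (hM (p, r) a * hM (q, s) b)).
  apply: eq_bigr => p _; rewrite summxE; apply: eq_bigr => q _.
  rewrite mxE sweedler_coord => [|w c x y]; last first.
    by rewrite mulrDr -scalerAr tensorDl tensorZl.
  rewrite summxE mulr_sumr; apply: eq_bigr => r _.
  rewrite summxE mulr_sumr; apply: eq_bigr => s _.
  by rewrite !mxE mulrA.
symmetry; rewrite sum_pair; apply: eq_bigr => p _.
under eq_bigr => r _ do rewrite sum_pair.
exact: exchange_big.
Qed.

Section Values.
Variables (R : comNzRingType) (iota : {rmorphism k -> R}).

(** The matrix of [g |-> f * g]. *)
Definition cconv_mx f : 'M[R]_n := \matrix_(i, b) cconv iota hC f (delta R b) i.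

Lemma cconv_mxM f g : cconv_mx f *m cconv_mx g = cconv_mx (cconv iota hC f g).
Proof.
apply/matrixP => i c; rewrite !mxE -cconvA [RHS]cconv_delta.
by apply: eq_bigr => b _; rewrite !mxE.
Qed.

Lemma cconv_mx_eps : cconv_mx (ceps iota hC) = 1%:M.
Proof. by apply/matrixP => i c; rewrite !mxE cconv_epsl. Qed.

Lemma cconv_mx_col f g : cconv_mx f *m (\col_b g b) = \col_i cconv iota hC f g i.
Proof.
apply/colP => i; rewrite !mxE [RHS]cconv_delta.
by apply: eq_bigr => b _; rewrite !mxE.
Qed.

(** Cramer's rule for a convolution inverse. *)
Lemma cconv_Cramer f g i : cconv iota hC f g = ceps iota hC ->
  \det (cconv_mx f) * g i = \sum_l \adj (cconv_mx f) i l * iota (hE l).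
Proof.
move=> fg; have : (\det (cconv_mx f))%:M *m (\col_b g b) =
    \adj (cconv_mx f) *m \col_l ceps iota hC l.
  by rewrite -mul_adj_mx -mulmxA cconv_mx_col fg.
move/colP/(_ i); rewrite mul_scalar_mx mxE [(\col_b g b) i 0]mxE => ->.
by rewrite mxE; apply: eq_bigr => l _; rewrite [X in _ * X]mxE.
Qed.

End Values.

Lemma cconv_mx_map (R R' : comNzRingType) (iota : {rmorphism k -> R})
    (iota' : {rmorphism k -> R'}) (h : {rmorphism R -> R'}) f :
  (forall c, h (iota c) = iota' c) ->
  map_mx h (cconv_mx iota f) = cconv_mx iota' (h \o f).
Proof.
by move=> hi; apply/matrixP => i c; rewrite !mxE (cconv_map hi) delta_map.
Qed.


End Coordinates.

(** * The algebras generated by the [t_x] and by the cocycle *)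

Section Span.
Variables (B A : comNzRingType) (iota : {rmorphism B -> A}).
Variables (n : nat) (u : 'I_n -> A).

(** The [B]-submodule generated by the family [u]. *)
Definition span (x : A) := exists v : 'I_n -> B, x = \sum_i iota (v i) * u i.

Lemma spanD x y : span x -> span y -> span (x + y).
Proof.
move=> [v ->] [w ->]; exists (fun i => v i + w i); rewrite -big_split.
by apply: eq_bigr => i _; rewrite rmorphD mulrDl.
Qed.

Lemma spanZ b x : span x -> span (iota b * x).
Proof.
move=> [v ->]; exists (fun i => b * v i); rewrite mulr_sumr.
by apply: eq_bigr => i _; rewrite rmorphM mulrA.
Qed.

Lemma span0 : span 0.
Proof. by exists (fun=> 0); rewrite big1 // => i _; rewrite rmorph0 mul0r. Qed.

Lemma span_sum (T : finType) (F : T -> A) :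
  (forall i, span (F i)) -> span (\sum_i F i).
Proof. by move=> FP; apply: big_ind => //; [exact: span0 | exact: spanD]. Qed.

Lemma span_gen i : span (u i).
Proof.
exists (fun j => (i == j)%:R).
by under eq_bigr do rewrite rmorph_nat; rewrite sum_deltal.
Qed.

Lemma spanM x y : (forall i j, span (u i * u j)) ->
  span x -> span y -> span (x * y).
Proof.
move=> uu [v ->] [w ->]; rewrite big_distrlr.
apply: span_sum => i; apply: span_sum => j /=.
by rewrite /= mulrACA -rmorphM; apply: spanZ.
Qed.

Lemma span_scalar b : span 1 -> span (iota b).
Proof. by move=> ?; rewrite -[iota b]mulr1; apply: spanZ. Qed.

End Span.

(** A determinant belongs to every subring that contains the entries. *)
Lemma det_closed (A : comNzRingType) (P : A -> Prop) n (M : 'M[A]_n) :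
  P 0 -> P 1 -> P (-1) -> (forall x y, P x -> P y -> P (x + y)) ->
  (forall x y, P x -> P y -> P (x * y)) ->
  (forall i j, P (M i j)) -> P (\det M).
Proof.
move=> P0 P1 PN PD PM MP; rewrite /determinant; apply: big_ind => // s _.
apply/PM; last by apply: big_ind => //.
by elim: (odd_perm s : nat) => [|j IH]; rewrite ?expr0 // exprS; apply/PM.
Qed.

Section FreeHopfAlgebra.
Variables (k : fieldType) (H : fdHopfType k).
Local Notation n := (\dim {:H}).
Local Notation I := 'I_n.
Local Notation e := (@ebas k H).
Local Notation K := (symfrac H).
Local Notation A := (Stheta H).
Local Notation B := (BH H).
Local Notation inB := (subalg_pred (@BH_gen k H)).
Local Notation kA := (in_alg (Stheta H)).
Local Notation C := (hC H).
Local Notation m := (@hM k H).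
Local Notation iota := (\val : B -> A).
Local Notation kappa := (\val : A -> K).

Lemma ttheta_is_linear : linear (@ttheta k H).
Proof. by move=> c x y; apply: val_inj; rewrite /= linearP. Qed.
Lemma ttheta_inv_is_linear : linear (@ttheta_inv k H).
Proof. by move=> c x y; apply: val_inj; rewrite /= linearP. Qed.
HB.instance Definition _ := GRing.isLinear.Build k H A _ (@ttheta k H)
  ttheta_is_linear.
HB.instance Definition _ := GRing.isLinear.Build k H A _ (@ttheta_inv k H)
  ttheta_inv_is_linear.

(** The generators [t_x] and [t^-1_x] for [x] in the canonical basis. *)
Definition tA (i : I) : A := ttheta (e i).
Definition tA' (i : I) : A := ttheta_inv (e i).

Lemma tA_tA' : cconv kA C tA tA' = ceps kA C.
Proof.
apply: funext => i; apply: val_inj.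
have [+ _] := tinvP (e i).
rewrite sweedler_coord => [tE|w c x y]; last by rewrite linearP mulrDl -scalerAl.
rewrite -[RHS]tE raddf_sum; apply: eq_bigr => a _; rewrite raddf_sum.
by apply: eq_bigr => b _; rewrite mulr_algl.
Qed.

Lemma tA'_tA : cconv kA C tA' tA = ceps kA C.
Proof.
apply: funext => i; apply: val_inj.
have [_ +] := tinvP (e i).
rewrite sweedler_coord => [tE|w c x y]; last by rewrite linearP mulrDl -scalerAl.
rewrite -[RHS]tE raddf_sum; apply: eq_bigr => a _; rewrite raddf_sum.
by apply: eq_bigr => b _; rewrite mulr_algl.
Qed.

Lemma tthetaE x : ttheta x = \sum_i ecrd i x *: tA i.
Proof.
by rewrite {1}(ecrdK x) linear_sum; apply: eq_bigr => i _; rewrite linearZ.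
Qed.

Lemma ttheta_invE x : ttheta_inv x = \sum_i ecrd i x *: tA' i.
Proof.
by rewrite {1}(ecrdK x) linear_sum; apply: eq_bigr => i _; rewrite linearZ.
Qed.

Lemma pull_mul f p : pull kA m f p = \sum_l m p l *: f l.
Proof. by apply: eq_bigr => l _; rewrite mulr_algl. Qed.

Lemma comul_sum (U : lmodType k) (G : I -> I -> U) x :
  \sum_a \sum_b comul x a b *: G a b =
  \sum_i ecrd i x *: \sum_a \sum_b hD i a b *: G a b.
Proof.
under [RHS]eq_bigr do rewrite scaler_sumr.
rewrite [RHS]exchange_big; apply: eq_bigr => a _ /=.
under [RHS]eq_bigr do rewrite scaler_sumr.
rewrite [RHS]exchange_big; apply: eq_bigr => b _ /=.
by rewrite comul_coord scaler_suml; apply: eq_bigr => i _; rewrite scalerA.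
Qed.

Lemma cconv2E f g i j : cconv kA (ctens C C) f g (i, j) =
  \sum_a \sum_b hD i a b *: \sum_c \sum_d hD j c d *: (f (a, c) * g (b, d)).
Proof.
rewrite /cconv sum_pair; apply: eq_bigr => a _.
under eq_bigr => c _ do rewrite sum_pair.
rewrite exchange_big; apply: eq_bigr => b _ /=.
rewrite scaler_sumr; apply: eq_bigr => c _; rewrite scaler_sumr.
by apply: eq_bigr => d _; rewrite mulr_algl scalerA.
Qed.

Lemma sigmaE x y : sigma x y =
  \sum_i ecrd i x *: \sum_j ecrd j y *: cocycle kA C m tA tA' (i, j).
Proof.
rewrite /sigma sweedler_coord => [|w c z z']; last first.
  rewrite /sweedler scaler_sumr -big_split; apply: eq_bigr => s _ /=.
  by rewrite linearP !mulrDl -!scalerAl.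
rewrite comul_sum; apply: eq_bigr => i _; congr (_ *: _).
under eq_bigr => a _.
  under eq_bigr => b _.
    rewrite sweedler_coord => [|w c z z']; last first.
      by rewrite linearP mulrDr mulrDl -scalerAr -scalerAl.
    rewrite comul_sum scaler_sumr.
    over.
  rewrite exchange_big /=.
  over.
rewrite exchange_big; apply: eq_bigr => j _ /=.
rewrite /cocycle cconv2E scaler_sumr; apply: eq_bigr => a _.
rewrite scaler_sumr; apply: eq_bigr => b _; rewrite !scalerA mulrC.
congr (_ *: _); apply: eq_bigr => c _; apply: eq_bigr => d _.
by rewrite pull_mul /tensf /= ttheta_invE.
Qed.

Lemma sigma_invE x y : sigma_inv x y =
  \sum_i ecrd i x *: \sum_j ecrd j y *: cocycle_inv kA C m tA tA' (i, j).
Proof.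
rewrite /sigma_inv sweedler_coord => [|w c z z']; last first.
  rewrite /sweedler scaler_sumr -big_split; apply: eq_bigr => s _ /=.
  by rewrite mulrDl -scalerAl linearP !mulrDl -!scalerAl.
rewrite comul_sum; apply: eq_bigr => i _; congr (_ *: _).
under eq_bigr => a _.
  under eq_bigr => b _.
    rewrite sweedler_coord => [|w c z z']; last first.
      by rewrite mulrDr -scalerAr linearP !mulrDl -!scalerAl.
    rewrite comul_sum scaler_sumr.
    over.
  rewrite exchange_big /=.
  over.
rewrite exchange_big; apply: eq_bigr => j _ /=.
rewrite /cocycle_inv cconv2E scaler_sumr; apply: eq_bigr => a _.
rewrite scaler_sumr; apply: eq_bigr => b _; rewrite !scalerA mulrC.
congr (_ *: _); apply: eq_bigr => c _; apply: eq_bigr => d _.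
by rewrite pull_mul /tensf /= mulrA tthetaE.
Qed.

Lemma sigma_ebas i j : sigma (e i) (e j) = cocycle kA C m tA tA' (i, j).
Proof.
rewrite sigmaE; under eq_bigr => a _ do rewrite ecrd_ebas.
rewrite (bigD1 i) //= eqxx scale1r [X in _ + X]big1 ?addr0 => [|a /negPf->]; last first.
  by rewrite scale0r.
under eq_bigr => a _ do rewrite ecrd_ebas.
rewrite (bigD1 j) //= eqxx scale1r big1 ?addr0 // => a /negPf->.
by rewrite scale0r.
Qed.

Lemma sigma_inv_ebas i j :
  sigma_inv (e i) (e j) = cocycle_inv kA C m tA tA' (i, j).
Proof.
rewrite sigma_invE; under eq_bigr => a _ do rewrite ecrd_ebas.
rewrite (bigD1 i) //= eqxx scale1r [X in _ + X]big1 ?addr0 => [|a /negPf->]; last first.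
  by rewrite scale0r.
under eq_bigr => a _ do rewrite ecrd_ebas.
rewrite (bigD1 j) //= eqxx scale1r big1 ?addr0 // => a /negPf->.
by rewrite scale0r.
Qed.

Lemma sigma_inB x y : sigma x y \in inB.
Proof. by apply/subalg_predP/in_subalg_gen; exists x, y; left. Qed.

Lemma sigma_inv_inB x y : sigma_inv x y \in inB.
Proof. by apply/subalg_predP/in_subalg_gen; exists x, y; right. Qed.

Lemma cocycle_inB p : cocycle kA C m tA tA' p \in inB.
Proof. by case: p => i j; rewrite -sigma_ebas sigma_inB. Qed.

Lemma cocycle_inv_inB p : cocycle_inv kA C m tA tA' p \in inB.
Proof. by case: p => i j; rewrite -sigma_inv_ebas sigma_inv_inB. Qed.

Lemma scalar_inB c : kA c \in inB.
Proof. by apply/rpredZ/rpred1. Qed.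

End FreeHopfAlgebra.

Section Generation.
Variables (k : fieldType) (H : fdHopfType k).
Local Notation n := (\dim {:H}).
Local Notation I := 'I_n.
Local Notation e := (@ebas k H).
Local Notation K := (symfrac H).
Local Notation A := (Stheta H).
Local Notation B := (BH H).
Local Notation inB := (subalg_pred (@BH_gen k H)).
Local Notation kA := (in_alg (Stheta H)).
Local Notation C := (hC H).
Local Notation m := (@hM k H).
Local Notation iota := (\val : B -> A).
Local Notation kappa := (\val : A -> K).
Local Notation spanA := (span iota).
Local Notation t := (@tA k H).
Local Notation t' := (@tA' k H).

Lemma inBP (z : A) : z \in inB -> exists b : B, iota b = z.
Proof. by move=> zB; exists (Subalg zB). Qed.

Lemma span_inB (u : I -> A) z x : z \in inB -> spanA u x -> spanA u (z * x).
Proof. by move=> /inBP[b <-]; apply: spanZ. Qed.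

Lemma span_pull (u : I -> A) p : spanA u (pull kA m u p).
Proof.
by apply: span_sum => l; apply: (span_inB _ (span_gen _ _ _)); apply: scalar_inB.
Qed.

Lemma spanZk (u : I -> A) c x : spanA u x -> spanA u (c *: x).
Proof. by move=> ux; rewrite -mulr_algl; apply/span_inB/ux/scalar_inB. Qed.

(** The [B]-module generated by the [t_x] is closed under multiplication,
    and so is the one generated by the [t^-1_x]. *)
Lemma tA_mul i j : spanA t (t i * t j).
Proof.
rewrite -[_ * _]/(tensf t t (i, j)) -(cocycleK (hM_mor H) (tA'_tA H)).
apply: span_sum => a; apply: span_sum => b /=.
apply: (span_inB (scalar_inB _ _)); apply: (span_inB (cocycle_inB _)).
exact: span_pull.
Qed.

Lemma tA'_mul i j : spanA t' (t' i * t' j).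
Proof.
rewrite -[_ * _]/(tensf t' t' (i, j)) -(cocycle_invK (hM_mor H) (tA'_tA H)).
apply: span_sum => a; apply: span_sum => b /=.
apply: (span_inB (scalar_inB _ _)); rewrite mulrC.
by apply: (span_inB (cocycle_inv_inB _)); apply: span_pull.
Qed.

Lemma sweedler11 (U : lmodType k) (f : H -> H -> U) :
  (forall w, linear (f^~ w)) -> (forall w, linear (f w)) ->
  sweedler (comul (1 : H)) f = f 1 1.
Proof.
move=> fl fr.
have fl' w c x y : f (c *: x + y) w = c *: f x w + f y w := fl w c x y.
have fr' w c x y : f w (c *: x + y) = c *: f w x + f w y := fr w c x y.
have f0l w : f 0 w = 0.
  by have := fl' w (-1) 0 0; rewrite scaler0 addr0 scaleN1r addNr.
have f0r w : f w 0 = 0.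
  by have := fr' w (-1) 0 0; rewrite scaler0 addr0 scaleN1r addNr.
rewrite comul1 sweedler_tensor // => [v w w'|c v w].
- by rewrite -[w]scale1r fr' !scale1r.
- by rewrite -[c *: v]addr0 -[c *: w]addr0 fl' fr' f0l f0r.
Qed.

Lemma ttheta1K : ttheta 1 * ttheta_inv 1 = 1 :> A.
Proof.
apply: val_inj; have [+ _] := tinvP (1 : H).
rewrite counit1 scale1r sweedler11 // => w c x y.
  by rewrite linearP mulrDl -scalerAl.
by rewrite linearP mulrDr -scalerAr.
Qed.

Lemma sigma11 : sigma 1 1 = ttheta 1 :> A.
Proof.
rewrite /sigma !sweedler11 => [|w c x y|w c x y|w c x y|w c x y].
- by rewrite mul1r -mulrA ttheta1K mulr1.
- by rewrite linearP mulrDr -scalerAr !mulrDl -!scalerAl.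
- by rewrite !mul1r linearP mulrDr -scalerAr.
- rewrite /sweedler scaler_sumr -big_split; apply: eq_bigr => s _ /=.
  by rewrite linearP !mulrDl -!scalerAl.
- rewrite /sweedler scaler_sumr -big_split; apply: eq_bigr => s _ /=.
  by rewrite mulrDl -scalerAl linearP mulrDr -scalerAr.
Qed.

Lemma sigma_inv11 : sigma_inv 1 1 = ttheta_inv 1 :> A.
Proof.
rewrite /sigma_inv !sweedler11 => [|w c x y|w c x y|w c x y|w c x y].
- by rewrite mul1r ttheta1K mul1r.
- by rewrite !mul1r linearP !mulrDl -!scalerAl.
- by rewrite linearP mulrDr -scalerAr.
- rewrite /sweedler scaler_sumr -big_split; apply: eq_bigr => s _ /=.
  by rewrite mulrDl -scalerAl linearP !mulrDl -!scalerAl.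
- rewrite /sweedler scaler_sumr -big_split; apply: eq_bigr => s _ /=.
  by rewrite linearP mulrDr -scalerAr !mulrDl -!scalerAl.
Qed.

(** The units [t_1 = sigma(1, 1)] and [t^-1_1 = sigma^-1(1, 1)] belong to
    [B]. *)
Lemma tA_span1 : spanA t 1.
Proof.
rewrite -ttheta1K mulrC; apply: span_inB.
  by rewrite -sigma_inv11 sigma_inv_inB.
by rewrite tthetaE; apply: span_sum => i; apply/spanZk/span_gen.
Qed.

Lemma tA'_span1 : spanA t' 1.
Proof.
rewrite -ttheta1K; apply: span_inB; first by rewrite -sigma11 sigma_inB.
by rewrite ttheta_invE; apply: span_sum => i; apply/spanZk/span_gen.
Qed.

Lemma span_det (u : I -> A) (M : 'M[A]_n) :
  (forall i j, spanA u (u i * u j)) -> spanA u 1 ->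
  (forall i j, spanA u (M i j)) -> spanA u (\det M).
Proof.
move=> uM u1 MP; apply: det_closed => //; first exact: span0.
- by rewrite -scaleN1r; apply: spanZk.
- exact: spanD.
- by move=> x y; apply: spanM.
Qed.

Let T := cconv_mx kA t.
Let T' := cconv_mx kA t'.

Lemma T_unit : T *m T' = 1%:M.
Proof. by rewrite cconv_mxM tA_tA' cconv_mx_eps. Qed.

Lemma cconv_mx_span (u : I -> A) i j : spanA u (cconv_mx kA u i j).
Proof.
rewrite mxE; apply: span_sum => a; apply: span_sum => b /=.
apply: (span_inB (scalar_inB _ _)); rewrite mulrC; apply: (span_inB _ (span_gen _ _ _)).
by rewrite /delta; apply: rpred_nat.
Qed.

(** The determinant of [T'] is the inverse of that of [T], and it stabilises the
    [B]-module generated by the [t^-1_x]. *)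
Lemma det_T' : spanA t (\det T').
Proof.
have yt' i : spanA t' (\det T' * t' i).
  apply: (spanM tA'_mul); last exact: span_gen.
  by apply: (span_det tA'_mul tA'_span1) => a b; apply: cconv_mx_span.
have [c cE] := boolp.choice yt'.
have [w wE] := tA'_span1.
apply: (@integral_inverse _ _ iota _ t' (\matrix_(i, l) c i l) w (\det T) _
  (spanA t)).
- by move=> i; rewrite cE; apply: eq_bigr => l _; rewrite mxE.
- exact: wE.
- by rewrite -det_mulmx T_unit det1.
- by move=> b; apply/span_scalar/tA_span1.
- by apply: (span_det tA_mul tA_span1) => a b; apply: cconv_mx_span.
- exact: spanD.
- by move=> x z; apply: (spanM tA_mul).
Qed.

Lemma tA'_span i : spanA t (t' i).
Proof.
have -> : t' i = \det T' * \sum_l \adj T i l * kA (hE l).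
  rewrite -(cconv_Cramer _ (tA_tA' H)) mulrA -det_mulmx.
  by rewrite [_ *m _]cconv_mxM tA'_tA cconv_mx_eps det1 mul1r.
apply: (spanM tA_mul det_T'); apply: span_sum => l; rewrite mulrC.
apply: (span_inB (scalar_inB _ _)); rewrite mxE /cofactor.
apply: span_inB; first by rewrite rpredX // rpredN rpred1.
apply: det_closed => [|||x y|x y|a b]; first exact: span0.
- exact: tA_span1.
- by rewrite -scaleN1r; apply/spanZk/tA_span1.
- exact: spanD.
- by apply: spanM tA_mul.
- by have := cconv_mx_span t (lift l a) (lift i b); rewrite !mxE.
Qed.

Theorem tA_generates (x : A) : spanA t x.
Proof.
case: x => z zA.
suff [x xz tx] : exists2 x : A, kappa x = z & spanA t x.
  by rewrite (_ : Subalg zA = x) //; apply: val_inj.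
move/subalg_predP: zA; elim=> {z} [c|z [x zE]|y z _ [y' <- ty] _ [z' <- tz]
  |y z _ [y' <- ty] _ [z' <- tz]].
- by exists (kA c) => //; apply/spanZk/tA_span1.
- case: zE => ->; first exists (ttheta x) => //.
    by rewrite tthetaE; apply: span_sum => i; apply/spanZk/span_gen.
  exists (ttheta_inv x) => //.
  by rewrite ttheta_invE; apply: span_sum => i; apply/spanZk/tA'_span.
- by exists (y' + z'); [rewrite rmorphD | exact: spanD].
- by exists (y' * z'); [rewrite rmorphM | exact: (spanM tA_mul ty tz)].
Qed.

(** [B] is generated as an algebra by the values of the cocycle on the
    canonical basis. *)
Theorem BH_noetherian : noetherian B.
Proof.
pose s : seq B := [seq Subalg (sigma_inB (e p.1) (e p.2)) | p : I * I] ++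
  [seq Subalg (sigma_inv_inB (e p.1) (e p.2)) | p : I * I].
have [P [g [nP gk gs]]] := noetherian_cover (in_alg B) s.
apply: (noetherian_surj (f := g)) nP => -[z zB].
suff [p pz] : exists p, iota (g p) = z by exists p; apply: val_inj.
have gD y z' : (exists p, iota (g p) = y) -> (exists p, iota (g p) = z') ->
    exists p, iota (g p) = y + z'.
  by move=> [p <-] [q <-]; exists (p + q); rewrite rmorphD.
have gM y z' : (exists p, iota (g p) = y) -> (exists p, iota (g p) = z') ->
    exists p, iota (g p) = y * z'.
  by move=> [p <-] [q <-]; exists (p * q); rewrite rmorphM.
have gc c : exists p, iota (g p) = kA c by have [p pE] := gk c; exists p; rewrite pE.
have gsum (F : I -> A) : (forall i, exists p, iota (g p) = F i) ->
    exists p, iota (g p) = \sum_i F i.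
  move=> FP; apply: (big_ind (fun z => exists p, iota (g p) = z)) => //.
  by exists 0; rewrite rmorph0 raddf0.
have gZ c y : (exists p, iota (g p) = y) -> exists p, iota (g p) = c *: y.
  by move=> gy; rewrite -mulr_algl; exact: (gM _ _ (gc c) gy).
move/subalg_predP: zB; elim=> {z} [c|z [x [y zE]]|y z _ IHy _ IHz|y z _ IHy _ IHz];
  [exact: gc | | exact: gD | exact: gM].
case: zE => ->; [rewrite sigmaE | rewrite sigma_invE];
  apply: (gsum) => i; apply: (gZ); apply: (gsum) => j; apply: (gZ).
  have [|p pE] := gs (Subalg (sigma_inB (e i) (e j))).
    by rewrite mem_cat; apply/orP; left; apply/mapP; exists (i, j); rewrite ?mem_enum.
  by exists p; rewrite pE /= sigma_ebas.
have [|p pE] := gs (Subalg (sigma_inv_inB (e i) (e j))).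
  by rewrite mem_cat; apply/orP; right; apply/mapP; exists (i, j); rewrite ?mem_enum.
by exists p; rewrite pE /= sigma_inv_ebas.
Qed.

End Generation.

(** * The largest commutative quotient *)

Section CommutativeQuotient.
Variables (k : fieldType) (H : fdHopfType k).
Local Notation n := (\dim {:H}).
Local Notation I := 'I_n.
Local Notation e := (@ebas k H).
Local Notation I3 := ((I * I) * I)%type.
Local Notation N := #|{: I3}|.

Lemma m3E (p : I3) c : m3 (@hM k H) p c = ecrd c (e p.1.1 * e p.1.2 * e p.2).
Proof.
rewrite hMulE mulr_suml ecrd_suml /m3 /mor_comp /mor_tens_id sum_pair.
apply: eq_bigr => q _; rewrite -scalerAl ecrdZ.
under eq_bigr do rewrite /= -mulrA.
by rewrite -mulr_sumr sum_deltal.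
Qed.

(** The rows of [comm_mx] are the coordinates of the elements
    [(e_i e_j - e_j e_i) e_l], which span the commutator ideal of [H]. *)
Definition comm_mx : 'M[k]_(N, n) := \matrix_(a, c)
  (m3 (@hM k H) (enum_val a) c - m3 (@hM k H) (swap (enum_val a)) c).

(** The row of coordinates of an element of [H]. *)
Definition crd (x : H) : 'rV[k]_n := \row_i ecrd i x.

Lemma crd_is_linear : linear crd.
Proof. by move=> c x y; apply/rowP => i; rewrite !mxE ecrd_is_linear. Qed.
HB.instance Definition _ := GRing.isLinear.Build k H 'rV[k]_n _ crd crd_is_linear.

Lemma row_comm_mx a : let p := enum_val a in
  row a comm_mx = crd ((e p.1.1 * e p.1.2 - e p.1.2 * e p.1.1) * e p.2).
Proof.
apply/rowP => c; rewrite !mxE !m3E /= mulrBl.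
by rewrite /ecrd linearB.
Qed.

(** The matrix of the right multiplication by [x]. *)
Definition right_mx (x : H) : 'M[k]_n := \matrix_(i, l) ecrd l (e i * x).

Lemma right_mx_is_linear : linear right_mx.
Proof.
by move=> c x y; apply/matrixP => i l; rewrite !mxE mulrDr -scalerAr ecrd_is_linear.
Qed.
HB.instance Definition _ := GRing.isLinear.Build k H 'M[k]_n _ right_mx
  right_mx_is_linear.

Lemma crdM x y : crd (x * y) = crd x *m right_mx y.
Proof.
apply/rowP => l; rewrite !mxE {1}(ecrdK x) mulr_suml ecrd_suml.
by apply: eq_bigr => i _; rewrite -scalerAl ecrdZ !mxE.
Qed.

Lemma row_right_mx i x : row i (right_mx x) = crd (e i * x).
Proof. by apply/rowP => l; rewrite !mxE. Qed.

Lemma right_mxM x y : right_mx (x * y) = right_mx x *m right_mx y.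
Proof.
by apply/row_matrixP => i; rewrite row_mul !row_right_mx mulrA crdM.
Qed.

Lemma right_mx1 : right_mx 1 = 1%:M.
Proof. by apply/matrixP => i l; rewrite !mxE mulr1 ecrd_ebas eq_sym. Qed.

(** A matrix killed by [comm_mx] gives functionals that vanish on the whole
    commutator ideal. *)
Lemma comm_mx_ideal p (L : 'M[k]_(n, p)) : comm_mx *m L = 0 ->
  forall x y z, crd ((x * y - y * x) * z) *m L = 0.
Proof.
move=> JL.
have base i j l : crd ((e i * e j - e j * e i) * e l) *m L = 0.
  have := congr1 (row (enum_rank ((i, j), l))) JL.
  by rewrite row_mul row_comm_mx enum_rankK row0.
have comb (q : H) (f : {linear H -> 'rV[k]_p}) : (forall i, f (e i) = 0) -> f q = 0.
  move=> f0; rewrite (ecrdK q) linear_sum big1 // => i _.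
  by rewrite linearZ /= f0 scaler0.
move=> x y z.
have lin (f : H -> 'rV[k]_p) : linear f -> (forall i, f (e i) = 0) -> forall q, f q = 0.
  by move=> fL f0 q; apply: (comb q (HB.pack f (GRing.isLinear.Build _ _ _ _ f fL))).
apply: (lin (fun z => crd ((x * y - y * x) * z) *m L)) => [c u v|l].
  by rewrite mulrDr -scalerAr linearP mulmxDl -scalemxAl.
apply: (lin (fun y => crd ((x * y - y * x) * e l) *m L)) => [c u v|j].
  rewrite mulrDr [(_ + _) * x]mulrDl -scalerAr -scalerAl opprD addrACA -scalerBr mulrDl.
  by rewrite -scalerAl linearP mulmxDl -scalemxAl.
apply: (lin (fun x => crd ((x * e j - e j * x) * e l) *m L)) => [c u v|i].
  rewrite mulrDr [(_ + _) * e j]mulrDl -scalerAr -scalerAl opprD addrACA -scalerBr mulrDl.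
  by rewrite -scalerAl linearP mulmxDl -scalemxAl.
exact: base.
Qed.

(** The quotient of [H] by its commutator ideal, as an algebra of commuting
    matrices: [pi] is the action of the quotient on the space of functionals
    that vanish on the ideal, and [L] evaluates these functionals. *)
Lemma commutative_quotient : exists p (pi : {linear H -> 'M[k]_p.+1})
    (L : 'M[k]_(n, p.+1)),
  [/\ pi 1 = 1, forall x y, pi (x * y) = pi x * pi y,
      forall x y, pi x * pi y = pi y * pi x,
      forall x, crd 1 *m L *m pi x = crd x *m L &
      forall (F : fieldType) (f : {rmorphism k -> F}) (v : 'rV[F]_n),
        v *m map_mx f L = 0 -> (v <= map_mx f comm_mx)%MS].
Proof.
pose W := kermx comm_mx^T.
have kerP q (X : 'M[k]_(n, q)) : comm_mx *m X = 0 -> (X^T <= W)%MS.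
  by move=> JX; apply/sub_kermxP; rewrite -trmx_mul JX trmx0.
have W_gt0 : (0 < \rank W)%N.
  (* The counit is a nonzero functional that vanishes on commutators. *)
  pose E : 'cV[k]_n := \col_i hE i.
  have crdE x : (crd x *m E) 0 0 = counit x.
    rewrite [in RHS](ecrdK x) linear_sum mxE; apply: eq_bigr => i _.
    by rewrite linearZ !mxE.
  have JE : comm_mx *m E = 0.
    apply/row_matrixP => a; rewrite row_mul row_comm_mx row0.
    apply/rowP => i; rewrite ord1 crdE mxE counitM.
    by rewrite linearB /= !counitM [X in _ - X]mulrC subrr mul0r.
  rewrite lt0n mxrank_eq0; apply/eqP => W0.
  have := kerP _ _ JE; rewrite W0 submx0 trmx_eq0 => /eqP E0.
  have := crdE 1; rewrite E0 mulmx0 mxE counit1 => /eqP.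
  by rewrite eq_sym oner_eq0.
have [p pE] : exists p, \rank W = p.+1 by exists (\rank W).-1; rewrite prednK.
have [L [L' [L'L JL LP]]] : exists (L : 'M[k]_(n, p.+1)) (L' : 'M[k]_(p.+1, n)),
    [/\ L' *m L = 1%:M, comm_mx *m L = 0 &
        forall q (X : 'M[k]_(n, q)), comm_mx *m X = 0 -> L *m (L' *m X) = X].
  rewrite -pE.
  have /row_freeP[D WD] := row_base_free W.
  have {}WD : D^T *m (row_base W)^T = 1%:M by rewrite -trmx_mul WD trmx1.
  exists (row_base W)^T, D^T; split.
  - exact: WD.
  - apply: trmx_inj; rewrite trmx_mul trmxK trmx0; apply/sub_kermxP.
    by rewrite eq_row_base.
  - move=> q X /kerP; rewrite -(eq_row_base W) => /submxP[Y XE].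
    rewrite -[X]trmxK XE (trmx_mul Y).
    by rewrite [D^T *m _]mulmxA WD mul1mx.
(* The functionals in the column space of [L] are stable under
   [lambda |-> lambda(_ x)], whose matrix in the columns of [L] is [pi0 x]. *)
pose pi0 x := L' *m right_mx x *m L : 'M[k]_p.+1.
have pi0L : linear pi0.
  by move=> c x y; rewrite /pi0 linearP mulmxDr mulmxDl -scalemxAr -scalemxAl.
pose pi : {linear H -> 'M[k]_p.+1} :=
  HB.pack pi0 (GRing.isLinear.Build _ _ _ _ pi0 pi0L).
have JR x : comm_mx *m (right_mx x *m L) = 0.
  apply/row_matrixP => a; rewrite row_mul row_comm_mx row0 mulmxA -crdM -mulrA.
  exact: comm_mx_ideal.
have LR x : L *m (L' *m right_mx x *m L) = right_mx x *m L.
  by rewrite -mulmxA LP.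
have piM x y : pi0 (x * y) = pi0 x *m pi0 y.
  by rewrite /pi0 right_mxM -[RHS]mulmxA LR !mulmxA.
exists p, pi, L; split=> [|x y|x y|x|F f v vL].
- by rewrite -[LHS]/(pi0 1) /pi0 right_mx1 mulmx1 L'L.
- exact: piM.
- rewrite -[LHS]/(pi0 x *m pi0 y) -[RHS]/(pi0 y *m pi0 x) -!piM.
  apply/eqP; rewrite -subr_eq0 /pi0 -mulmxBl -mulmxBr -linearB -mulmxA.
  apply/eqP; rewrite (_ : right_mx _ *m L = 0) ?mulmx0 //.
  apply/row_matrixP => i; rewrite row_mul row_right_mx row0.
  have -> : e i * (x * y - y * x) =
      (e i * x * y - y * (e i * x)) * 1 - (e i * y - y * e i) * x.
    by rewrite mulr1 mulrBl mulrBr !mulrA opprB addrA subrK.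
  by rewrite linearB mulmxBl !comm_mx_ideal // subrr.
- by rewrite -[pi x]/(pi0 x) -mulmxA LR mulmxA -crdM mul1r.
- rewrite submxE -map_cokermx -(LP _ (cokermx comm_mx)) ?mulmx_coker //.
  by rewrite map_mxM mulmxA vL mul0mx.
Qed.

End CommutativeQuotient.

(** * The coaction of the commutative quotient *)

Section Coaction.
Variables (k : fieldType) (H : fdHopfType k).
Local Notation n := (\dim {:H}).
Local Notation I := 'I_n.
Local Notation e := (@ebas k H).
Local Notation S := (symalg H).
Local Notation K := (symfrac H).
Local Notation A := (Stheta H).
Local Notation B := (BH H).
Local Notation kS := (in_alg S).
Local Notation kK := (in_alg K).
Local Notation kA := (in_alg A).
Local Notation C := (hC H).
Local Notation C2 := (ctens C C).
Local Notation m := (@hM k H).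
Local Notation iota := (\val : B -> A).
Local Notation kappa := (\val : A -> K).
Local Notation t := (@tA k H).
Local Notation t' := (@tA' k H).

Lemma kappa_scalar c : kappa (kA c) = kK c.
Proof. exact: linearZ. Qed.

(** The elements [t_x] and [t^-1_x] of the field of fractions. *)
Definition tK : I -> K := kappa \o t.
Definition tK' : I -> K := kappa \o t'.

Lemma tK_tK' : cconv kK C tK tK' = ceps kK C.
Proof.
apply: funext => i; rewrite -(cconv_map kappa_scalar) tA_tA'.
exact: kappa_scalar.
Qed.

Lemma tofrac_scalar c : tofrac (kS c) = kK c.
Proof. exact: (esym (mulr1 (symfrac_scalar H c))). Qed.

(** The ring [D] plays the part of [K (x) Q], where [Q] is a commutative quotient
    of [H], [pi] the quotient map in the canonical basis, and [pi'] its
    composite with the antipode. *)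
Variables (D : comNzRingType) (s : {rmorphism K -> D}).
Local Notation kD := (s \o kK).
Variables (pi pi' : I -> D).
Hypothesis piM : pull kD m pi = tensf pi pi.
Hypothesis pipi' : cconv kD C pi pi' = ceps kD C.

Let tD : I -> D := s \o tK.
Let tD' : I -> D := s \o tK'.

(** The images [t_(x_1) pi(x_2)] and [pi'(x_1) t^-1_(x_2)] of [t_x] and
    [t^-1_x] under the coaction. *)
Definition rho := cconv kD C tD pi.
Definition rho' := cconv kD C pi' tD'.

Let kDE c : s (kK c) = kD c. Proof. by []. Qed.

Let tD_tD' : cconv kD C tD tD' = ceps kD C.
Proof. by apply: funext => i; rewrite -(cconv_map kDE) tK_tK'. Qed.

Let rhoK : cconv kD C rho rho' = ceps kD C.
Proof. exact: (twistK tD_tD' pipi'). Qed.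

(** The ring morphism [t_x |-> t_(x_1) pi(x_2)] on the symmetric algebra. *)
Definition coaction : {rmorphism {mpoly k[n]} -> D} := mmap kD rho.

Let f : {rmorphism S -> D} := coaction.

Let f_scalar c : f (kS c) = kD c.
Proof. by rewrite [LHS]mmapZ [X in _ * X]rmorph1 mulr1. Qed.

Let f_var i : f 'X_i = rho i.
Proof. by rewrite [LHS]mmapX mmap1U. Qed.

Local Notation graph := (frac_graph f).

Lemma graph_scalar c : graph (kK c) (kD c).
Proof. by rewrite -tofrac_scalar -f_scalar; apply: frac_graph_tofrac. Qed.

Lemma graph_t i : graph (tK i) (rho i).
Proof.
rewrite -f_var (_ : tK i = tofrac ('X_i : S)); first exact: frac_graph_tofrac.
by rewrite -symvar_ebas.
Qed.

(** By Cramer's rule [t^-1_x] has as denominator the determinant of the matrix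
    of convolution with [t], which the coaction maps to a unit. *)
Lemma graph_t' i : graph (tK' i) (rho' i).
Proof.
pose tS (i : I) : S := 'X_i.
have tKE : tK = @tofrac S \o tS.
  by apply: funext => j /=; rewrite /tS -symvar_ebas.
have rhoE : rho = f \o tS by apply: funext => j; rewrite -f_var.
have mxK : map_mx (@tofrac S) (cconv_mx kS tS) = cconv_mx kK tK.
  by rewrite (@cconv_mx_map k H S K kS kK (@tofrac S) tS tofrac_scalar) tKE.
have mxD : map_mx f (cconv_mx kS tS) = cconv_mx kD rho.
  by rewrite (@cconv_mx_map k H S D kS kD f tS f_scalar) rhoE.
pose th := \det (cconv_mx kS tS).
have thK : tofrac th = \det (cconv_mx kK tK) by rewrite -mxK det_map_mx.
have thD : f th = \det (cconv_mx kD rho) by rewrite -mxD det_map_mx.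
exists (\sum_l \adj (cconv_mx kS tS) i l * kS (hE l)), th; split.
- apply/eqP => th0; have := tK_tK' => /(congr1 (fun g => \det (cconv_mx kK g))).
  rewrite -cconv_mxM det_mulmx -thK th0 tofrac0 mul0r cconv_mx_eps det1.
  by move/eqP; rewrite eq_sym oner_eq0.
- exists (\det (cconv_mx kD rho')).
  by rewrite thD -det_mulmx cconv_mxM rhoK cconv_mx_eps det1.
- rewrite mulrC thK (cconv_Cramer i tK_tK') rmorph_sum; apply: eq_bigr => l _.
  rewrite rmorphM; congr (_ * _); last exact: (esym (tofrac_scalar _)).
  by rewrite -mxK -map_mx_adj mxE.
- rewrite thD (cconv_Cramer i rhoK) rmorph_sum; apply: eq_bigr => l _.
  rewrite rmorphM f_scalar; congr (_ * _).
  by rewrite -mxD -map_mx_adj [RHS]mxE.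
Qed.

Lemma graph_cconv (J : finType) (E : coalg k J) F F' G G' i :
  (forall a, graph (F a) (F' a)) -> (forall a, graph (G a) (G' a)) ->
  graph (cconv kK E F G i) (cconv kD E F' G' i).
Proof.
move=> FF GG; apply: frac_graph_sum => a; apply: frac_graph_sum => b.
by apply: frac_graphM; [exact: graph_scalar | exact: frac_graphM].
Qed.

Lemma graph_pull G G' p : (forall a, graph (G a) (G' a)) ->
  graph (pull kK m G p) (pull kD m G' p).
Proof.
move=> GG; apply: frac_graph_sum => l.
by apply: frac_graphM; [exact: graph_scalar | exact: GG].
Qed.

(** The coaction fixes [B], because [rho] and [t] have the same cocycle. *)
Lemma graph_B (b : B) : graph (kappa (iota b)) (s (kappa (iota b))).
Proof.
pose P z := graph (kappa z) (s (kappa z)).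
have PD y z : P y -> P z -> P (y + z).
  by move=> Py Pz; rewrite /P !rmorphD; apply: frac_graphD.
have PM y z : P y -> P z -> P (y * z).
  by move=> Py Pz; rewrite /P !rmorphM; apply: frac_graphM.
have Pc c : P (kA c) by rewrite /P kappa_scalar; apply: graph_scalar.
have PZ c z : P z -> P (c *: z).
  by move=> Pz; rewrite -mulr_algl; apply: (PM _ _ (Pc c) Pz).
have P0 : P 0 by rewrite /P !rmorph0; apply: frac_graph0.
have PS (T : finType) (F : T -> A) : (forall i, P (F i)) -> P (\sum_i F i).
  by move=> FP; apply: (big_ind P).
have Pcocycle p : P (cocycle kA C m t t' p).
  rewrite /P (cocycle_map kappa_scalar) (cocycle_map kDE).
  rewrite -/tK -/tK' -/tD -/tD'.
  rewrite -(twist_cocycle (hM_mor H) tD tD' pipi' piM).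
  apply: graph_cconv => [a|a]; last exact/graph_pull/graph_t'.
  by apply: frac_graphM; apply: graph_t.
have Pcocycle_inv p : P (cocycle_inv kA C m t t' p).
  rewrite /P (cocycle_inv_map kappa_scalar) (cocycle_inv_map kDE).
  rewrite -/tK -/tK' -/tD -/tD'.
  rewrite -(twist_cocycle_inv (hM_mor H) tD tD' pipi' piM).
  apply: graph_cconv => [a|a]; first exact/graph_pull/graph_t.
  by apply: frac_graphM; apply: graph_t'.
case: b => z zB; change (P z); move/subalg_predP: zB.
elim=> {z} [c|z [x [y zE]]|y z _ IHy _ IHz|y z _ IHy _ IHz].
- exact: Pc.
- by case: zE => ->; [rewrite sigmaE | rewrite sigma_invE];
    apply: (PS) => i; apply: (PZ); apply: (PS) => j; apply: (PZ).
- exact: PD.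
- exact: PM.
Qed.

(** A relation between the [t_x] over [B] is preserved by the coaction. *)
Lemma coaction_rel (v : I -> B) : \sum_i iota (v i) * t i = 0 ->
  \sum_i s (kappa (iota (v i))) * rho i = 0.
Proof.
move=> vt; apply: (frac_graph_fun (f := f) (a := 0)); last exact: frac_graph0.
have <- : \sum_i kappa (iota (v i)) * tK i = 0.
  transitivity (kappa (\sum_i iota (v i) * t i)); last by rewrite vt rmorph0.
  by rewrite rmorph_sum; apply: eq_bigr => i _; rewrite rmorphM.
apply: frac_graph_sum => i.
by apply: frac_graphM; [exact: graph_B | exact: graph_t].
Qed.

End Coaction.

(** * A dual basis over the cocycle algebra *)

Section Conclusion.
Variables (k : fieldType) (H : fdHopfType k).
Local Notation n := (\dim {:H}).
Local Notation I := 'I_n.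
Local Notation e := (@ebas k H).
Local Notation K := (symfrac H).
Local Notation A := (Stheta H).
Local Notation B := (BH H).
Local Notation kK := (in_alg K).
Local Notation kA := (in_alg A).
Local Notation C := (hC H).
Local Notation C3 := (ctens (ctens C C) C).
Local Notation m := (@hM k H).
Local Notation iota := (\val : B -> A).
Local Notation kappa := (\val : A -> K).
Local Notation t := (@tA k H).
Local Notation t' := (@tA' k H).
Local Notation I3 := ((I * I) * I)%type.
Local Notation N := #|{: I3}|.
Local Notation r := (\rank (comm_mx H)).

(** The matrix of convolution with [t]. *)
Let Phi : 'M[A]_n := cconv_mx kA t.

Let PhiK : map_mx kappa Phi = cconv_mx kK (@tK k H).
Proof. exact: (cconv_mx_map _ (@kappa_scalar k H)). Qed.

Let Phi_unit : map_mx kappa Phi \in unitmx.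
Proof.
rewrite PhiK.
have tt' : cconv_mx kK (@tK k H) *m cconv_mx kK (@tK' k H) = 1%:M.
  by rewrite cconv_mxM tK_tK' cconv_mx_eps.
exact: (proj1 (mulmx1_unit tt')).
Qed.

(** A relation between the [t_x] with coefficients in [B] is a combination of
    commutators once multiplied by [Phi]: the coaction, composed with the
    projection onto the commutative quotient, kills it. *)
Lemma relation_comm_mx (v : 'rV[B]_n) :
  map_mx iota v *m (\col_i t i) = 0 ->
  (map_mx (kappa \o iota) v *m map_mx kappa Phi <= map_mx kK (comm_mx H))%MS.
Proof.
move=> vt; have [p [pi [L [pi1 piM piC LE relP]]]] := commutative_quotient H.
apply: relP.
(* The commutative ring [D] in which the coaction takes its values is the double
   commutant of the image of [pi] in the matrices over [K]. *)
pose piK x : 'M[K]_p.+1 := map_mx kK (pi x).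
pose G (y : 'M[K]_p.+1) := exists x, y = piK x.
have piKM x y : piK (x * y) = piK x * piK y.
  by rewrite /piK piM; apply: map_mxM.
have piK_lin x : piK x = \sum_l kK (ecrd l x) *: piK (e l).
  rewrite {1}(ecrdK x) /piK linear_sum raddf_sum; apply: eq_bigr => l _.
  by rewrite linearZ; apply: map_mxZ.
have GC : commuting G.
  move=> _ _ [x ->] [y ->]; rewrite -!piKM /piK !piM.
  by congr (map_mx _ _); apply: piC.
pose D := double_commutant GC.
have scal_in c : c%:M \in double_commutant_pred G.
  by apply/double_commutantP => y _; apply: (esym (scalar_mxC c y)).
pose s0 c : D := DoubleCommutant GC (scal_in c).
have s0B : zmod_morphism s0.
  by move=> c d; apply: val_inj; apply: raddfB.
have s0M : monoid_morphism s0.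
  by split=> [|c d]; apply: val_inj; [|apply: rmorphM].
pose s : {rmorphism K -> D} := HB.pack s0
  (GRing.isZmodMorphism.Build _ _ s0 s0B) (GRing.isMonoidMorphism.Build _ _ s0 s0M).
have pi_in x : piK x \in double_commutant_pred G.
  by apply/double_commutantP => y yC; rewrite yC //; exists x.
pose piD x : D := DoubleCommutant GC (pi_in x).
pose kD : {rmorphism k -> D} := s \o kK.
have dcM (x y : D) : dc_val (x * y) = dc_val x *m dc_val y by [].
have dc_sum (T : finType) (F : T -> D) : dc_val (\sum_i F i) = \sum_i dc_val (F i).
  exact: (raddf_sum (\val : D -> 'M[K]_p.+1)).
have piD_pull : pull kD m (piD \o e) = tensf (piD \o e) (piD \o e).
  apply: funext => -[i j]; apply: val_inj.
  transitivity (piK (e i * e j)); last exact: piKM.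
  rewrite [LHS]dc_sum piK_lin; apply: eq_bigr => l _.
  by rewrite [LHS]dcM; apply: mul_scalar_mx.
have piD_inv : cconv kD C (piD \o e) (piD \o @antipode k H \o e) = ceps kD C.
  apply: funext => i; apply: val_inj; rewrite [LHS]dc_sum.
  have := congr1 piK (antipode_r (e i)).
  rewrite sweedler_coord => [|w c x y]; last by rewrite mulrDl -scalerAl.
  rewrite {2}/piK linearZ pi1 => piE.
  transitivity (map_mx kK ((counit (e i) : k) *: (1 : 'M[k]_p.+1))); last first.
    by rewrite map_mxZ map_mx1 scalemx1.
  rewrite -piE /piK linear_sum raddf_sum; apply: eq_bigr => a _.
  rewrite dc_sum linear_sum raddf_sum; apply: eq_bigr => b _.
  rewrite linearZ [RHS]map_mxZ -/(piK _) piKM [LHS]dcM.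
  by rewrite [dc_val (_ * _)]dcM; apply: mul_scalar_mx.
have vt0 : \sum_i iota (v 0 i) * t i = 0.
  transitivity ((map_mx iota v *m \col_i t i) 0 0); last by rewrite vt mxE.
  by rewrite mxE; apply: eq_bigr => i _; rewrite !mxE.
have := coaction_rel piD_pull piD_inv vt0.
(* The row [u] recovers [x] modulo commutators from [pi x]. *)
pose u := map_mx kK (crd 1 *m L).
move=> /(congr1 (fun y => u *m dc_val y)).
have up x : u *m piK x = map_mx kK (crd x *m L) by rewrite -map_mxM LE.
rewrite dc_sum mulmx_sumr mulmx0 => E.
have rhoE i : u *m dc_val (rho s (piD \o e) i) =
    row i (map_mx kappa Phi) *m map_mx kK L.
  rewrite /rho cconv_delta dc_sum mulmx_sumr mulmx_sum_row.
  apply: eq_bigr => b _.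
  have -> : cconv kD C (s \o @tK k H) (delta D b) i = s (map_mx kappa Phi i b).
    rewrite PhiK [in RHS]mxE -(delta_map s) -(@cconv_map _ _ _ kK kD s) //.
  rewrite dcM [dc_val (s _)]/= mul_scalar_mx -scalemxAr up [row _ _ 0 b]mxE.
  congr (_ *: _); rewrite -map_row rowE; congr (map_mx _ (_ *m _)).
  by apply/rowP => c; rewrite !mxE ecrd_ebas eq_sym.
rewrite -mulmxA -E mulmx_sum_row; apply: eq_bigr => i _.
rewrite row_mul -rhoE dcM [dc_val (s _)]/= mul_scalar_mx -scalemxAr.
by rewrite [map_mx _ v 0 i]mxE.
Qed.

Local Notation inB := (subalg_pred (@BH_gen k H)).

Lemma cconv_inB (T : finType) (E : coalg k T) f g i :
  (forall a, f a \in inB) -> (forall a, g a \in inB) ->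
  cconv kA E f g i \in inB.
Proof.
move=> fB gB; apply: rpred_sum => a _; apply: rpred_sum => b _.
by apply: rpredM; [exact: scalar_inB | exact: rpredM].
Qed.

Lemma pull_inB (T U : finType) (phi : T -> U -> k) f i :
  (forall a, f a \in inB) -> pull kA phi f i \in inB.
Proof.
move=> fB; apply: rpred_sum => a _.
by apply: rpredM; [exact: scalar_inB | exact: fB].
Qed.

Lemma commutator_rel_inB c p : commutator_rel kA C m t t' (delta A c) p \in inB.
Proof.
suff relB q : cconv kA C3 (cocycle3 kA C m t t') (pull kA (m3 m) (delta A c)) q
    \in inB by apply: rpredB; apply: relB.
apply: cconv_inB => a; last by apply: pull_inB => b; apply: rpred_nat.
rewrite (cocycle3E (hM_mor H) (tA'_tA H)); apply: cconv_inB => b.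
  by apply: rpredM; [exact: cocycle_inB | exact: scalar_inB].
by apply: pull_inB => d; apply: cocycle_inB.
Qed.

(** The matrix of the relations [commutator_rel]. *)
Let M : 'M[B]_(N, n) :=
  \matrix_(a, c) Subalg (commutator_rel_inB c (enum_val a)).

Let iotaM a c : map_mx iota M a c =
  commutator_rel kA C m t t' (delta A c) (enum_val a).
Proof. by rewrite !mxE. Qed.

Let ttt' := tensf (tensf t' t') t'.

(** The matrix of convolution with the inverse of [t (x) t (x) t]. *)
Let P : 'M[A]_N :=
  \matrix_(a, b) cconv kA C3 ttt' (delta A (enum_val b)) (enum_val a).

Let PMPhi : P *m map_mx iota M *m Phi = map_mx kA (comm_mx H).
Proof.
apply/matrixP => a c; rewrite -mulmxA mxE.
have MPhi b : (map_mx iota M *m Phi) b c =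
    commutator_rel kA C m t t' (cconv kA C t (delta A c)) (enum_val b).
  rewrite mxE commutator_rel_delta; apply: eq_bigr => l _.
  by rewrite iotaM [Phi _ _]mxE.
under eq_bigr do rewrite MPhi [P _ _]mxE.
rewrite (sum_enum_val (fun b => cconv kA C3 ttt' (delta A b) (enum_val a) *
  commutator_rel kA C m t t' (cconv kA C t (delta A c)) b)) /=.
rewrite -cconv_delta (commutator_relK (hM_mor H) (tA'_tA H)).
by rewrite /commutator_val !pull_deltaE !mxE rmorphB.
Qed.

Let t_rel : map_mx iota M *m (\col_i t i) = 0.
Proof.
apply/colP => a; rewrite mxE [RHS]mxE.
rewrite -[RHS](commutator_rel0 (hM_mor H) (tA'_tA H) (enum_val a)).
rewrite [RHS]commutator_rel_delta; apply: eq_bigr => l _.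
by rewrite iotaM mxE.
Qed.

(* [U] and [V] bring the constant matrix [comm_mx H] to the identity of size
   its rank. *)
Let U : 'M[k]_(r, N) := pid_mx r *m invmx (col_ebase (comm_mx H)).
Let V : 'M[k]_(n, r) := invmx (row_ebase (comm_mx H)) *m pid_mx r.

Let UJV : U *m comm_mx H *m V = 1%:M.
Proof.
transitivity (U *m (col_ebase (comm_mx H) *m pid_mx r *m
    row_ebase (comm_mx H)) *m V).
  by congr (_ *m _ *m _); rewrite mulmx_ebase.
rewrite /U /V -!mulmxA mulKmx ?col_ebase_unit // mulKVmx ?row_ebase_unit //.
rewrite mulmxA pid_mx_id ?rank_leq_row // pid_mx_id ?rank_leq_col //.
exact: pid_mx_1.
Qed.

Let XMY : map_mx kA U *m P *m map_mx iota M *m (Phi *m map_mx kA V) = 1%:M.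
Proof.
rewrite mulmxA -[X in X *m map_mx kA V]mulmxA -[X in X *m map_mx kA V]mulmxA.
by rewrite [P *m _]mulmxA PMPhi -!map_mxM UJV map_mx1.
Qed.

Theorem Stheta_dual_basis : has_dual_basis iota t 1.
Proof.
apply: (@dual_basis1 _ _ iota val_inj _ t (@tA_generates k H) _ kappa val_inj
  _ _ (map_mx kappa Phi) (map_mx kK (comm_mx H)) M (map_mx kA U *m P)
  (Phi *m map_mx kA V)).
- by rewrite mxrank_map.
- exact: Phi_unit.
- exact: t_rel.
- exact: relation_comm_mx.
- exact: XMY.
Qed.

End Conclusion.

(** * Modules with a dual basis *)

Section DualBasisModules.
Variables (R : nzRingType) (M : lmodType R) (n : nat) (t : 'I_n -> M).
Variable phi : M -> 'I_n -> R.
Hypothesis phiL : forall c x y i, phi (c *: x + y) i = c * phi x i + phi y i.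

Lemma dual_basis_projective :
  (forall x, x = \sum_i phi x i *: t i) -> projective M.
Proof.
move=> phiE N P p f p_surj.
have [u uP] := boolp.choice (fun i => p_surj (f (t i))).
pose g0 x := \sum_i phi x i *: u i.
have g0L : linear g0.
  move=> c x y; rewrite /g0 scaler_sumr -big_split; apply: eq_bigr => i _.
  by rewrite phiL scalerDl scalerA.
pose g : {linear M -> N} := HB.pack g0 (GRing.isLinear.Build _ _ _ _ g0 g0L).
exists g => x; rewrite -[g x]/(g0 x).
rewrite [in RHS](phiE x) /g0 !linear_sum; apply: eq_bigr => i _.
by rewrite !linearZ uP.
Qed.

Lemma dual_basis_generator (s : seq (M * 'I_n)) :
  \sum_(p <- s) phi p.1 p.2 = 1 -> generator M.
Proof.
move=> s1 N P f g fg y.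
have hL i : linear (fun x => phi x i *: y).
  by move=> c x z; rewrite phiL scalerDl scalerA.
have hE x i : f (phi x i *: y) = g (phi x i *: y).
  pose h : {linear M -> N} := HB.pack (fun x => phi x i *: y)
    (GRing.isLinear.Build _ _ _ _ (fun x => phi x i *: y) (hL i)).
  exact: (fg h x).
rewrite -[y]scale1r -s1 scaler_suml !linear_sum.
by apply: eq_bigr => p _; apply: hE.
Qed.

End DualBasisModules.

Theorem theorem3p6 (k : fieldType) (H : fdHopfType k) :
  noetherian (BH H) /\
  (finitely_generated (Stheta_BH H) /\ projective (Stheta_BH H)) /\
  generator (Stheta_BH H).
Proof.
have [phi phi_dual] := Stheta_dual_basis H.
have [s s1] := dual_basis_trace val_inj (@tA_generates k H) phi_dual.
have [phiL phiE] := phi_dual.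
split; first exact: BH_noetherian.
split; last exact: (@dual_basis_generator _ (Stheta_BH H) _ phi phiL s s1).
split.
  by exists (\dim {:H}), (@tA k H) => x; apply: tA_generates.
apply: (@dual_basis_projective _ (Stheta_BH H) _ (@tA k H) phi phiL) => x.
by rewrite -[LHS](mul1r (x : Stheta H)); apply: phiE.
Qed.
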